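(* Let $\Phi$ be a class of prenex pp-formulas (with liberal variables) over a relational signature $\tau$. Then: (i) $\Phi$ satisfies the tractability condition if and only if there exists $k\ge 1$ such that each formula in $\Phi$ has a $\sharp\mathsf{PP}$-representation $\phi'$ with $\mathsf{width}(\phi')\le k$; (ii) $\Phi$ satisfies the contraction condition if and only if there exists $k\ge1$ such that each formula in $\Phi$ has a $\sharp\mathsf{PP}$-representation $\phi'$ with $\sharp\text{-}\mathsf{width}(\phi')\le k$.
   Context: Structures are finite relational $\tau$-structures, no equality. A pp-formula is built from atoms $R(v_1,\dots,v_k)$ ($R\in\tau$, $v_i$ variables) using $\wedge$ and $\exists$. A prenex pp-formula with liberal variables $S$ is identified with a pair $(\mathbf{A},S)$ with $S\subseteq A$: the universe $A$ consists of $S$ and all variables of the formula, $R^{\mathbf{A}}$ is the set of tuples $(a_1,\dots,a_k)$ with $R(a_1,\dots,a_k)$ an atom, and variables in $A\setminus S$ are existentially quantified. For a structure $\mathbf{B}$, $\phi(\mathbf{B})$ is the set of maps $f:S\to B$ that extend to a homomorphism $\mathbf{A}\to\mathbf{B}$. The graph $G$ of $(\mathbf{A},S)$ has vertex set $A\cup S$, with an edge between two vertices occurring together in a tuple of some relation of $\mathbf{A}$; the treewidth of the formula is the treewidth of $G$. An $\exists$-component of $(\mathbf{A},S)$ is an induced subgraph $G[V']$ where $V$ is a connected component of $G[A\setminus S]$ and $V'$ is $V$ together with all vertices of $S$ adjacent to $V$. $\mathsf{contract}(\mathbf{A},S)$ is the graph on vertex set $S$ obtained from $G[S]$ by adding an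 edge between any two vertices lying together in some $\exists$-component. A core of $(\mathbf{A},S)$ is $(c(\mathbf{A}),S)$ where $c$ is an endomorphism of $\mathbf{A}$ fixing every element of $S$ with minimum image size, and $c(\mathbf{A})$ has universe $c(A)$ and $R^{c(\mathbf{A})}=\{c(t): t\in R^{\mathbf{A}}\}$ (unique up to isomorphism). $\Phi$ satisfies the contraction condition if the graphs $\mathsf{contract}(\psi)$, $\psi$ ranging over cores of formulas of $\Phi$, have bounded treewidth; it satisfies the tractability condition if it satisfies the contraction condition and the cores of formulas of $\Phi$ have bounded treewidth. $\sharp$-formulas (over $\tau$): inductively, with free and closed variable sets: $C(\phi,L)$ ($\phi$ first-order, $L\supseteq\mathrm{free}(\phi)$; free $L$, closed $\emptyset$); $PV\psi$ ($V\cap\mathrm{closed}(\psi)=\emptyset$; free $\mathrm{free}(\psi)\setminus V$, closed $V\cup\mathrm{closed}(\psi)$); $EV\psi$ ($V$ disjoint from free and closed variables of $\psi$; free $V\cup\mathrm{free}(\psi)$, closed $\mathrm{closed}(\psi)$); $\psi\times\psi'$ (equal free sets, disjoint closed sets; free $\mathrm{free}(\psi)$, closed the union); $\psi+\psi'$ (equal free sets; free $\mathrm{free}(\psi)$, closed the union); $n\in\mathbb{Z}$ (no free or closed variables). Semantics, for $h:\mathrm{free}\to B$: $[\mathbf{B},C(\phi,L)](h)$ is $1$ if $\mathbf{B},h\models\phi$ else $0$; $[\mathbf{B},PV\psi](h)=\sum[\mathbf{B},\psi](h')$ over extensions $h'$ of $h$ to $\mathrm{free}(\psi)\cup V$; $[\mathbf{B},EV\psi](h)=[\mathbf{B},\psi](h|_{\mathrm{free}(\psi)})$;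 $\times,+$ pointwise; $[\mathbf{B},n](h)=n$. $\sharp$-subformulas are subtrees of the formula tree; fo-subformulas are subformulas of first-order formulas $\phi$ occurring as $C(\phi,L)$. $\mathsf{width}(\psi)$ is the maximum of $|\mathrm{free}(\theta)|$ over all $\sharp$-subformulas and fo-subformulas $\theta$; $\sharp\text{-}\mathsf{width}(\psi)$ is that maximum over $\sharp$-subformulas only. A $\sharp\mathsf{PP}$-formula is a $\sharp$-formula in which every $C(\phi,L)$ has $\phi$ a pp-formula. A $\sharp$-sentence (no free variables) $\psi$ is a representation of $\phi(S)$ if $|\phi(\mathbf{B})|=[\mathbf{B},\psi](\epsilon)$ for every finite $\mathbf{B}$, $\epsilon$ the empty assignment. *)

(* Defs.v *)
From HB Require Import structures.
From mathcomp Require Import all_boot all_order all_algebra.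
From mathcomp Require Import finmap boolp.

Set Implicit Arguments.
Unset Strict Implicit.
Unset Printing Implicit Defensive.

(** * Graphs and treewidth *)

Definition induced (T : finType) (e : rel T) (X : {set T}) : rel T :=
  [rel x y | [&& x \in X, y \in X & e x y]].

Definition is_tree (N : finType) (e : rel N) : Prop :=
  [/\ 0 < #|N|, symmetric e, irreflexive e,
      (forall x y, connect e x y) &
      (forall c : seq N, 2 < size c -> ~~ ucycleb e c)].

Definition tree_decomposition (T : finType) (g : rel T)
    (N : finType) (e : rel N) (bag : N -> {set T}) : Prop :=
  [/\ is_tree e,
      (forall v, exists n, v \in bag n),
      (forall u v, g u v -> exists n, (u \in bag n) && (v \in bag n)) &
      (forall v n m, v \in bag n -> v \in bag m ->
         connect (induced e [set i | v \in bag i]) n m)].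

(* The width of a decomposition is the maximal bag size minus one. *)
Definition treewidth_le (T : finType) (g : rel T) (w : nat) : Prop :=
  exists (N : finType) (e : rel N) (bag : N -> {set T}),
    tree_decomposition g e bag /\ forall n, #|bag n| <= w.+1.

(** * Structures and prenex pp-formulas *)

Record signature := Signature { sym : eqType; arity : sym -> nat }.

Record fstruct (tau : signature) := FStruct {
  univ :> finType;
  interp : forall R : sym tau, {set (arity R).-tuple univ}
}.

Definition is_hom (tau : signature) (A B : fstruct tau) (h : A -> B) : Prop :=
  forall (R : sym tau) (t : (arity R).-tuple A),
    t \in interp A R -> map_tuple h t \in interp B R.

(* A prenex pp-formula with liberal variables S, as a pair (A, S).  The
   signature may be infinite, but a formula has only finitely many atoms, hence
   [pp_fin]. *)
Record pp_formula (tau : signature) := PPFormula {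
  pp_struct : fstruct tau;
  pp_lib : {set pp_struct};
  pp_fin : exists s : seq (sym tau),
    forall R, interp pp_struct R != set0 -> R \in s
}.

Definition lib_type (tau : signature) (phi : pp_formula tau) : finType :=
  {x : pp_struct phi | x \in pp_lib phi}.

Definition answers (tau : signature) (phi : pp_formula tau) (B : fstruct tau) :
    {set {ffun lib_type phi -> B}} :=
  [set f : {ffun lib_type phi -> B} |
    `[< exists h : pp_struct phi -> B,
          is_hom h /\ forall s : lib_type phi, h (val s) = f s >]].

(** * The graph of a formula, ∃-components, contraction *)

Definition pp_graph (tau : signature) (phi : pp_formula tau) :
    rel (pp_struct phi) :=
  [rel x y | (x != y) &&
    `[< exists (R : sym tau) (t : (arity R).-tuple (pp_struct phi)),
          [/\ t \in interp (pp_struct phi) R, x \in t & y \in t] >]].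

(* Vertex set of the connected component of [a] in G[A \ S], for [a] not in S. *)
Definition quant_component (tau : signature) (phi : pp_formula tau)
    (a : pp_struct phi) : {set pp_struct phi} :=
  [set b | connect (induced (@pp_graph tau phi) (~: pp_lib phi)) a b].

(* Vertex set of the ∃-component arising from that connected component. *)
Definition ex_component (tau : signature) (phi : pp_formula tau)
    (a : pp_struct phi) : {set pp_struct phi} :=
  quant_component a :|:
  [set s in pp_lib phi | [exists v in quant_component a, pp_graph s v]].

Definition contract (tau : signature) (phi : pp_formula tau) :
    rel (lib_type phi) :=
  [rel x y | (x != y) &&
    (pp_graph (val x) (val y) ||
     [exists a, [&& a \notin pp_lib phi, val x \in ex_component a
                  & val y \in ex_component a]])].

(** * Cores *)

Definition fixing_endo (tau : signature) (phi : pp_formula tau)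
    (c : pp_struct phi -> pp_struct phi) : Prop :=
  is_hom c /\ forall s, s \in pp_lib phi -> c s = s.

Definition core_endo (tau : signature) (phi : pp_formula tau)
    (c : pp_struct phi -> pp_struct phi) : Prop :=
  fixing_endo c /\
  forall d : pp_struct phi -> pp_struct phi, fixing_endo d ->
    #|codom c| <= #|codom d|.

Definition image_struct (tau : signature) (A : fstruct tau) (c : A -> A) :
    fstruct tau :=
  @FStruct tau {x : A | x \in codom c}
    (fun R => [set t | map_tuple val t \in
                         [set map_tuple c u | u in interp A R]]).

Lemma image_fin (tau : signature) (phi : pp_formula tau)
    (c : pp_struct phi -> pp_struct phi) :
  exists s : seq (sym tau),
    forall R, interp (image_struct c) R != set0 -> R \in s.
Proof.
have [s hs] := pp_fin phi; exists s => R /set0Pn [t].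
rewrite inE => /imsetP [u uR _]; apply: hs.
by apply/set0Pn; exists u.
Qed.

(* The formula (c(A), S); it is a core of (A, S) when [core_endo c]. *)
Definition image_formula (tau : signature) (phi : pp_formula tau)
    (c : pp_struct phi -> pp_struct phi) : pp_formula tau :=
  @PPFormula tau (image_struct c) [set x | val x \in pp_lib phi] (image_fin c).

Definition contraction_condition (tau : signature)
    (Phi : pp_formula tau -> Prop) : Prop :=
  exists w : nat, forall phi, Phi phi ->
    forall c : pp_struct phi -> pp_struct phi, core_endo c ->
      treewidth_le (@contract tau (image_formula c)) w.

Definition tractability_condition (tau : signature)
    (Phi : pp_formula tau -> Prop) : Prop :=
  contraction_condition Phi /\
  exists w : nat, forall phi, Phi phi ->
    forall c : pp_struct phi -> pp_struct phi, core_endo c ->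
      treewidth_le (@pp_graph tau (image_formula c)) w.

(** * First-order formulas (without equality) *)

Definition var := nat.

Inductive fo (tau : signature) : Type :=
| FAtom (R : sym tau) (args : (arity R).-tuple var)
| FNot (p : fo tau)
| FAnd (p q : fo tau)
| FOr (p q : fo tau)
| FEx (x : var) (p : fo tau)
| FAll (x : var) (p : fo tau).

Fixpoint fo_free (tau : signature) (p : fo tau) : {fset var} :=
  match p with
  | FAtom R args => [fset x in tval args]%fset
  | FNot p => fo_free p
  | FAnd p q | FOr p q => (fo_free p `|` fo_free q)%fset
  | FEx x p | FAll x p => (fo_free p `\ x)%fset
  end.

Fixpoint fo_sub (tau : signature) (p : fo tau) : seq (fo tau) :=
  p :: match p with
       | FAtom _ _ => [::]
       | FNot p => fo_sub p
       | FAnd p q | FOr p q => fo_sub p ++ fo_sub q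
       | FEx _ p | FAll _ p => fo_sub p
       end.

Fixpoint is_pp (tau : signature) (p : fo tau) : bool :=
  match p with
  | FAtom _ _ => true
  | FAnd p q => is_pp p && is_pp q
  | FEx _ p => is_pp p
  | _ => false
  end.

(* Partial assignments: [h x = None] means that x is not in the domain of h. *)
Definition assignment (T : Type) := var -> option T.

Definition empty_assignment (T : Type) : assignment T := fun=> None.

Definition restrict (T : Type) (h : assignment T) (L : {fset var}) :
    assignment T :=
  fun x => if x \in L then h x else None.

Definition override (T : Type) (h : assignment T) (V : {fset var})
    (g : {ffun V -> T}) : assignment T :=
  fun x => if insub x is Some v then Some (g v) else h x.

Definition update (T : Type) (h : assignment T) (x : var) (b : T) :
    assignment T :=
  fun y => if y == x then Some b else h y.

Fixpoint sat (tau : signature) (B : fstruct tau) (h : assignment B)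
    (p : fo tau) : bool :=
  match p with
  | FAtom R args =>
      [exists t : (arity R).-tuple B,
         (t \in interp B R) && (map h args == map Some t)]
  | FNot p => ~~ sat h p
  | FAnd p q => sat h p && sat h q
  | FOr p q => sat h p || sat h q
  | FEx x p => [exists b : B, sat (update h x b) p]
  | FAll x p => [forall b : B, sat (update h x b) p]
  end.

(** * ♯-formulas *)

Inductive sharp (tau : signature) : Type :=
| SC (p : fo tau) (L : {fset var})
| SP (V : {fset var}) (psi : sharp tau)
| SE (V : {fset var}) (psi : sharp tau)
| SMul (psi psi' : sharp tau)
| SAdd (psi psi' : sharp tau)
| SInt (n : int).

Fixpoint sharp_free (tau : signature) (psi : sharp tau) : {fset var} :=
  match psi with
  | SC _ L => L
  | SP V psi => (sharp_free psi `\` V)%fset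
  | SE V psi => (V `|` sharp_free psi)%fset
  | SMul psi _ | SAdd psi _ => sharp_free psi
  | SInt _ => fset0
  end.

Fixpoint sharp_closed (tau : signature) (psi : sharp tau) : {fset var} :=
  match psi with
  | SC _ _ => fset0
  | SP V psi => (V `|` sharp_closed psi)%fset
  | SE _ psi => sharp_closed psi
  | SMul psi psi' | SAdd psi psi' => (sharp_closed psi `|` sharp_closed psi')%fset
  | SInt _ => fset0
  end.

(* [sharp] is raw syntax; the ♯-formulas are its well-formed elements. *)
Fixpoint sharp_wf (tau : signature) (psi : sharp tau) : bool :=
  match psi with
  | SC p L => (fo_free p `<=` L)%fset
  | SP V psi => sharp_wf psi && [disjoint V & sharp_closed psi]%fset
  | SE V psi => [&& sharp_wf psi, [disjoint V & sharp_free psi]%fset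
                  & [disjoint V & sharp_closed psi]%fset]
  | SMul psi psi' => [&& sharp_wf psi, sharp_wf psi',
                         sharp_free psi == sharp_free psi'
                       & [disjoint sharp_closed psi & sharp_closed psi']%fset]
  | SAdd psi psi' => [&& sharp_wf psi, sharp_wf psi'
                       & sharp_free psi == sharp_free psi']
  | SInt _ => true
  end.

Fixpoint is_sharpPP (tau : signature) (psi : sharp tau) : bool :=
  match psi with
  | SC p _ => is_pp p
  | SP _ psi | SE _ psi => is_sharpPP psi
  | SMul psi psi' | SAdd psi psi' => is_sharpPP psi && is_sharpPP psi'
  | SInt _ => true
  end.

(* In the [SP] case the extensions of h, whose domain is free(psi) \ V, to
   free(psi) ∪ V are exactly the overrides of h by a map V -> B. *)
Fixpoint sharp_eval (tau : signature) (B : fstruct tau) (psi : sharp tau)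
    (h : assignment B) : int :=
  match psi with
  | SC p _ => if sat h p then 1%R else 0%R
  | SP V psi => (\sum_(g : {ffun V -> B}) sharp_eval psi (override h g))%R
  | SE _ psi => sharp_eval psi (restrict h (sharp_free psi))
  | SMul psi psi' => (sharp_eval psi h * sharp_eval psi' h)%R
  | SAdd psi psi' => (sharp_eval psi h + sharp_eval psi' h)%R
  | SInt n => n
  end.

Fixpoint sharp_sub (tau : signature) (psi : sharp tau) : seq (sharp tau) :=
  psi :: match psi with
         | SC _ _ | SInt _ => [::]
         | SP _ psi | SE _ psi => sharp_sub psi
         | SMul psi psi' | SAdd psi psi' => sharp_sub psi ++ sharp_sub psi'
         end.

Fixpoint sharp_fo_sub (tau : signature) (psi : sharp tau) : seq (fo tau) :=
  match psi with
  | SC p _ => fo_sub p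
  | SP _ psi | SE _ psi => sharp_fo_sub psi
  | SMul psi psi' | SAdd psi psi' => sharp_fo_sub psi ++ sharp_fo_sub psi'
  | SInt _ => [::]
  end.

Definition sharp_width (tau : signature) (psi : sharp tau) : nat :=
  \max_(theta <- sharp_sub psi) #|` sharp_free theta|.

Definition width (tau : signature) (psi : sharp tau) : nat :=
  maxn (\max_(theta <- sharp_sub psi) #|` sharp_free theta|)
       (\max_(p <- sharp_fo_sub psi) #|` fo_free p|).

(* As usual in first-order logic, the structures in which formulas are evaluated
   have non-empty universes. *)
Definition represents (tau : signature) (psi : sharp tau)
    (phi : pp_formula tau) : Prop :=
  [/\ sharp_wf psi, sharp_free psi = fset0 &
      forall B : fstruct tau, 0 < #|B| ->
        (#|answers phi B|%:Z)%R = sharp_eval psi (@empty_assignment B)].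

Definition sharpPP_representation (tau : signature) (psi : sharp tau)
    (phi : pp_formula tau) : Prop :=
  is_sharpPP psi /\ represents psi phi.

(* Main.v *)
(* From a representation to a decomposition: by distributivity, a ♯PP-sentence
   equals a finite linear combination of numbers of answers |phi_i(B)| of
   pp-formulas, and following the construction of the sentence one glues tree
   decompositions of contract(phi_i) (and, if the fo-subformulas have few free
   variables, of the graph of phi_i) of bag size bounded by the width.  Numbers of
   answers are multiplicative under products of structures, so by Dedekind's
   argument |phi(B)| = |phi_i(B)| for all B and a single i.  Blowing up a set of
   elements of B and comparing the resulting polynomials, phi and phi_i have
   equally many answers with any prescribed image; applied to B = A_i and B = A
   this yields homomorphisms between A and A_i that are bijective on the liberal
   variables, so the core of phi embeds into phi_i and inherits its decompositions.

   From a decomposition to a representation: the liberal variables of an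
   ∃-component, as well as those of an atom, form a clique of the contract graph
   and hence lie in a bag.  So phi is a conjunction of pp-formulas, each with its
   liberal variables in a bag, and counting is done by eliminating bags one by one;
   within an ∃-component the quantified variables are eliminated in the same way. *)

Require Import Defs.
From HB Require Import structures.
From mathcomp Require Import all_boot all_order all_algebra.
From mathcomp Require Import fingroup perm finmap boolp ring.

Set Implicit Arguments.
Unset Strict Implicit.
Unset Printing Implicit Defensive.

(** * Tree decompositions as lists of bags *)

(** The quantified part of a core may have large treewidth although its contract graph is thin, so
    the two equivalences need two notions of decomposition. The flag [s] of [decomposed] lets a
    single induction serve both. Gluing and elimination are inductions on lists of bags; trees as
    graphs occur only on entering and leaving [treewidth_le]. Equal counts constrain the liberal
    variables only. Control over the quantified ones comes from the minimality of the core: the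
    round trip from A to A' and back permutes S, a power of it fixes S pointwise, and the core
    cannot shrink any further, so the map from A to A' is injective on the core. Injectivity also
    keeps the quantified elements of the core away from the images of the liberal ones, and this
    turns a condition on single quantified vertices into one on whole ∃-components. In the converse
    direction, eliminating an ∃-component leaves its liberal variables free throughout. A bag of the
    graph (at most w'+1 elements) is therefore enlarged by a subset of a bag of the contract graph
    (at most w+1), whence the bound (w'+1)+(w+1). *)

Section RunningIntersection.
Variable T : choiceType.
Implicit Types (b p : {fset T}) (bs : seq {fset T}).

(* A tree decomposition as a list of bags in which every bag meets the union of
   the later ones inside a single bag; [fset0] as the witness allows forests. *)
Fixpoint rip bs : Prop :=
  if bs is b :: bs' then
    rip bs' /\ exists2 p, p \in fset0 :: bs' &
      forall b' x, b' \in bs' -> x \in b -> x \in b' -> x \in p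
  else True.

Lemma rip1 b : rip [:: b].
Proof. by split=> //; exists fset0; rewrite ?mem_head. Qed.

(** Whatever a bag of [bs2] shares with [bs1] passes through [L], so its old witness still works.
    Only [L] needs a new one, namely [r]. *)
Lemma rip_glue L bs2 bs1 r :
  rip (rcons bs2 L) -> rip bs1 -> r \in fset0 :: bs1 ->
  (forall b x, b \in bs1 -> x \in L -> x \in b -> x \in r) ->
  (forall b2 b1 x, b2 \in bs2 -> b1 \in bs1 -> x \in b2 -> x \in b1 ->
     x \in L) ->
  rip (rcons bs2 L ++ bs1).
Proof.
move=> rip2 rip_1 r1 Lr; elim: bs2 rip2 => [_ _|b bs2 IH] /=.
  by split=> //; exists r.
move=> [rip2 [p p2 bp]] b2L; split.
  by apply: IH => // c2 b1 x c2in; apply: b2L; rewrite inE c2in orbT.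
exists p; first by move: p2; rewrite !inE mem_cat => /orP[|] ->; rewrite ?orbT.
move=> b' x; rewrite mem_cat => /orP[b'2|b'1] xb xb'.
  exact: bp xb xb'.
apply: (bp L) => //; first by rewrite mem_rcons mem_head.
by apply: b2L xb xb'; rewrite ?mem_head.
Qed.

Lemma rip_rebase L bs L' :
  rip (rcons bs L) -> (forall b x, b \in bs -> x \in b -> x \in L' -> x \in L) ->
  rip (rcons (rcons bs L) L').
Proof.
move=> ripL bL; rewrite -cats1; apply: (rip_glue (r := L')) => //.
- exact: rip1.
- by rewrite !inE eqxx orbT.
- by move=> b x; rewrite inE => /eqP->.
- by move=> b2 b1 x b2in; rewrite inE => /eqP-> x2 xL; apply: bL x2 xL.
Qed.

(** Helly property of subtrees. If all of [K] recurs in later bags, a pair that shares only the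
    first bag lies in its witness [p], and induction applies; otherwise the first bag contains [K].
    The value [fset0] is for empty [K]. *)
Lemma rip_clique bs (K : T -> Prop) :
  rip bs ->
  (forall x y, K x -> K y -> exists2 b, b \in bs & (x \in b) && (y \in b)) ->
  exists2 p, p \in fset0 :: bs & forall x, K x -> x \in p.
Proof.
elim: bs => [|b bs IH] /=.
  move=> _ Kb; exists fset0; rewrite ?mem_head // => x Kx.
  by have [b] := Kb _ _ Kx Kx.
move=> [ripbs [p pbs bp]] Kb.
have [Kcov|] := pselect (forall x, K x -> exists2 b', b' \in bs & x \in b').
  have [||q qbs Kq] := IH => //.
    move=> x y Kx Ky; have [c] := Kb _ _ Kx Ky.
    rewrite inE => /orP[/eqP->|cbs] xyc; last by exists c.
    have /andP[xb yb] := xyc.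
    have [b1 b1in xb1] := Kcov _ Kx; have [b2 b2in yb2] := Kcov _ Ky.
    have xp := bp _ _ b1in xb xb1; have yp := bp _ _ b2in yb yb2.
    exists p; last by rewrite xp.
    by move: pbs xp; rewrite inE => /orP[/eqP->|//]; rewrite inE.
  by exists q => //; move: qbs; rewrite !inE => /orP[]->; rewrite ?orbT.
(* Since [v] occurs in no later bag, every pair of [v] with another element of [K] must lie in
   [b]. *)
move=> /existsNP[v] /not_implyP[Kv vbs].
exists b; first by rewrite !inE eqxx orbT.
move=> x Kx; have [c] := Kb _ _ Kv Kx.
rewrite inE => /orP[/eqP->|cbs] /andP[] //.
by move=> vc; case: vbs; exists c.
Qed.

End RunningIntersection.

(** The hypothesis on [F] covers both images under an injection and preimages under any map. Since
    [F fset0] need not be empty, the witness [fset0] is treated separately. *)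
Lemma rip_map (T T' : choiceType) (F : {fset T} -> {fset T'})
    (bs : seq {fset T}) :
  (forall x b0, x \in F b0 -> exists y, forall b, (x \in F b) = (y \in b)) ->
  rip bs -> rip (map F bs).
Proof.
move=> HF; elim: bs => //= b bs IH [/IH ripF [p pbs bp]]; split=> //.
have xFp b' x : b' \in bs -> x \in F b -> x \in F b' -> x \in F p.
  move=> b'in xb xb'; have [y Fy] := HF _ _ xb.
  by move: xb xb'; rewrite !Fy; apply: bp.
move: pbs; rewrite inE => /orP[/eqP p0|pbs]; last first.
  exists (F p); first by rewrite inE map_f ?orbT.
  by move=> _ x /mapP[b' b'in ->] xb xb'; apply: xFp xb xb'.
exists fset0; rewrite ?mem_head // => _ x /mapP[b' b'in ->] xb xb'.
have [y Fy] := HF _ _ xb.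
by have := xFp _ _ b'in xb xb'; rewrite p0 Fy inE.
Qed.

Lemma rip_imfset (T T' : choiceType) (f : T -> T') (bs : seq {fset T}) :
  injective f -> rip bs -> rip [seq [fset f x | x in b]%fset | b : {fset T} <- bs].
Proof.
move=> f_inj; apply: rip_map => x b0 /imfsetP[y /= yb ->].
by exists y => b; rewrite (mem_imfset _ _ f_inj).
Qed.

Lemma inducedE (N : finType) (e : rel N) (X : {set N}) x y :
  induced e X x y = [&& x \in X, y \in X & e x y].
Proof. by []. Qed.

(** * From tree decompositions to lists of bags *)

Section TreeToRip.
Variables (N : finType) (e : rel N).
Hypothesis treeN : is_tree e.

Lemma path_crosses (X : {set N}) x p :
  path e x p -> x \in X -> last x p \notin X ->
  exists u v, [/\ u \in X, v \notin X & e u v].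
Proof.
elim: p x => [|y p IH] x /=; first by move=> _ ->.
move=> /andP[exy pp] xX; case: (boolP (y \in X)) => [yX|yX _].
  exact: IH.
by exists x, y.
Qed.

Lemma path_induced (D : {set N}) x p :
  path (induced e D) x p -> path e x p /\ {subset p <= D}.
Proof.
elim: p x => [|y p IH] x //= /andP[/and3P[_ yD ->] /IH[-> pD]]; split=> // z.
by rewrite inE => /orP[/eqP->|/pD].
Qed.

(** If the path from [v] first meets [X] at some [y] other than [u], a path from [y] to [u] inside
    [X] and the edge from [u] to [v] close a cycle. So it comes back through [u] itself. *)
Lemma tree_reenter (X D : {set N}) u v q :
  (forall x y, x \in X -> y \in X -> connect (induced e X) x y) ->
  u \in X -> v \notin X -> e u v ->
  path (induced e D) v q -> last v q \in X -> u \in D.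
Proof.
move=> Xconn uX vX euv /shortenP[{}q pq uq _] lq.
have [peq qD] := path_induced pq.
have hasX : has (mem X) q.
  apply/hasP; exists (last v q) => //.
  case: q lq {pq uq peq qD} => [|a q] /= lq; first by rewrite lq in vX.
  exact: mem_last.
case/split_find: hasX uq peq qD lq {pq} => y q1 q2 yX q1X.
rewrite cat_rcons -cat_cons cat_uniq cat_path /=.
move=> /and3P[uvq1 _ _] /and3P[pq1 ey _] qD _.
have yD : y \in D by apply: qD; rewrite mem_cat mem_head orbT.
have [<-//|yu] := eqVneq y u.
have /connectP[r pr lr] := Xconn _ _ yX uX.
case/shortenP: pr lr => {}r pr ur _ lr.
have [per rX] := path_induced pr.
case: treeN => _ _ _ _ /(_ (v :: q1 ++ y :: r)).
(* Acyclicity speaks of cycles with at least three vertices: [v], [y] and, as [y] differs from [u],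
   a vertex of [r]. *)
have r0 : 0 < size r by case: r lr {pr ur per rX} => //= yy; rewrite yy eqxx in yu.
rewrite /= size_cat /= addnS !ltnS => /(_ (leq_trans r0 (leq_addl _ _))).
suff uc : uniq (v :: q1 ++ y :: r).
  rewrite /ucycleb uc /path.cycle rcons_cat cat_path /= pq1 ey rcons_path per -lr.
  by rewrite euv.
rewrite -cat_cons cat_uniq ur andbT; apply/andP; split; first exact: uvq1.
have yrX z : z \in y :: r -> z \in X by rewrite inE => /orP[/eqP->//|/rX].
apply/hasPn => z /yrX zX; rewrite inE negb_or.
apply/andP; split; first by apply: contraNneq vX => <-.
by apply: contra q1X => zq1; apply/hasP; exists z.
Qed.

End TreeToRip.

(** A connected set of nodes grows by one adjacent node [v] at a time. The new bag goes in front,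
    with the bag of the neighbour [u] of [v] as its witness. *)
Lemma tree_decomposition_enum (T : finType) (g : rel T) (N : finType)
    (e : rel N) (bag : N -> {set T}) (m : nat) :
  tree_decomposition g e bag -> m <= #|N| ->
  exists ns : seq N,
    [/\ uniq ns, size ns = m,
        forall x y, x \in ns -> y \in ns ->
          connect (induced e [set n in ns]) x y
      & rip [seq [fset x | x in bag n]%fset | n <- ns]].
Proof.
move=> [treeN _ _ bagconn].
have [N0 esym _ econn _] := treeN.
elim: m => [_|m IH mN]; first by exists [::].
have [ns [uns sns nsconn ripns]] := IH (ltnW mN).
have [ns0|[x xns]] : ns = [::] \/ exists x, x \in ns.
  by case: (ns) => [|x s]; [left | right; exists x; rewrite mem_head].
  have /card_gt0P[n _] := N0; exists [:: n]; split=> //.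
  - by rewrite -sns ns0.
  - by move=> x y; rewrite !inE => /eqP-> /eqP->.
  - exact: rip1.
have [y yns] : exists y, y \notin ns.
  apply: contrapT => /forallNP allns.
  have /(uniq_leq_size (enum_uniq N)) : {subset enum N <= ns}.
    by move=> z _; have /negP := allns z; rewrite negbK.
  by rewrite -cardE sns leqNgt mN.
have /connectP[q pq lq] := econn x y.
have [||u [v [uX vX euv]]] := @path_crosses _ _ [set n in ns] _ _ pq.
- by rewrite inE.
- by rewrite -lq inE.
have evu : e v u by rewrite esym.
move: (uX) (vX); rewrite !inE => uns' vns.
have sub : subrel (connect (induced e [set n in ns]))
                  (connect (induced e [set n in v :: ns])).
  apply: connect_sub => a b /and3P[]; rewrite !inE => ains bins eab.
  by apply: connect1; rewrite inducedE !inE ains bins eab !orbT.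
have cuv : connect (induced e [set n in v :: ns]) u v.
  by apply: connect1; rewrite inducedE !inE uns' eqxx euv orbT.
have cvu : connect (induced e [set n in v :: ns]) v u.
  by apply: connect1; rewrite inducedE !inE uns' eqxx evu orbT.
exists (v :: ns); split=> /=.
- by rewrite vns.
- by rewrite sns.
- move=> a b; rewrite !inE => /orP[/eqP->|ains] /orP[/eqP->|bins].
  + exact: connect0.
  + by apply: connect_trans cvu _; apply/sub/nsconn.
  + by apply: connect_trans cuv; apply/sub/nsconn.
  + exact/sub/nsconn.
- split=> //; exists [fset x | x in bag u]%fset.
    by rewrite inE (map_f (fun n => [fset x | x in bag n]%fset)) ?orbT.
  move=> _ z /mapP[n nns ->]; rewrite !inE /= => zv zn.
  (* The nodes whose bags contain [z] connect [v] with [n]; by [tree_reenter] this path uses [u], so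
     [z] lies in the bag of [u]. *)
  have /connectP[r pr lr] := bagconn _ _ _ zv zn.
  suff : u \in [set i | z \in bag i] by rewrite inE.
  apply: (tree_reenter treeN (X := [set n in ns]) _ uX vX euv pr).
    by move=> a b; rewrite !inE; apply: nsconn.
  by rewrite inE -lr.
Qed.

Lemma treewidth_rip (T : finType) (g : rel T) w :
  treewidth_le g w ->
  exists bs : seq {fset T},
    [/\ rip bs, forall b, b \in bs -> #|` b| <= w.+1,
        forall x, exists2 b, b \in bs & x \in b
      & forall x y, g x y -> exists2 b, b \in bs & (x \in b) && (y \in b)].
Proof.
move=> [N [e [bag [td szb]]]].
have [ns [uns sns _ ripns]] := tree_decomposition_enum td (leqnn _).
have inns n : n \in ns.
  have [||_ ->] := uniq_min_size uns (s2 := enum N).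
  - by move=> z _; rewrite mem_enum.
  - by rewrite sns cardE.
  - by rewrite mem_enum.
have [_ cov ecov _] := td.
exists [seq [fset x | x in bag n]%fset | n <- ns]; split=> //.
- move=> _ /mapP[n _ ->]; rewrite card_imfset //= -cardE; exact: szb.
- move=> x; have [n xn] := cov x.
  by exists [fset x | x in bag n]%fset; rewrite ?map_f ?inE.
- move=> x y /ecov[n /andP[xn yn]].
  by exists [fset x | x in bag n]%fset; rewrite ?map_f ?inE ?xn.
Qed.

(** * From lists of bags to tree decompositions *)

Section AddLeaf.
Variables (N : finType) (e : rel N) (n0 : N).

Definition add_leaf : rel (option N) := fun x y =>
  match x, y with
  | Some a, Some b => e a b
  | None, Some a | Some a, None => a == n0
  | None, None => false
  end.

Lemma connect_Some (D : {set N}) (D' : {set option N}) a b :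
  (forall x, x \in D -> Some x \in D') ->
  connect (induced e D) a b -> connect (induced add_leaf D') (Some a) (Some b).
Proof.
move=> DD' /connectP[p pp ->]; elim: p a pp => //= y p IH a /andP[].
move=> /and3P[aD yD eay] /IH; apply: connect_trans; apply: connect1.
by rewrite inducedE !DD' ?eay.
Qed.

(** A cycle through [None], rotated to start there, would have [Some n0] both as second and as last
    vertex; any other cycle already lives in the old tree. *)
Lemma add_leaf_tree : is_tree e -> is_tree add_leaf.
Proof.
move=> [N0 esym eirr econn eacyc]; split.
- by rewrite card_option.
- by move=> [a|] [b|] //=.
- by move=> [a|] //=.
- have cS a b : connect add_leaf (Some a) (Some b).
    have /connectP[p pp ->] := econn a b; elim: p a pp => //= y p IH a /andP[eay].
    by move=> /IH; apply: connect_trans; apply: connect1.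
  have cN : connect add_leaf None (Some n0) by apply: connect1; rewrite /= eqxx.
  have Nc : connect add_leaf (Some n0) None by apply: connect1; rewrite /= eqxx.
  move=> [a|] [b|] //.
  + exact: connect_trans (cS _ _) Nc.
  + exact: connect_trans cN (cS _ _).
- move=> c sc; apply/negP => cyc.
  case: (boolP (None \in c)) => [/rot_to[i s rots]|Nc].
    have cyc' : ucycle add_leaf (rot i c) by rewrite rot_ucycle.
    have ss : 1 < size s.
      by have := congr1 size rots; rewrite size_rot /= => sz; rewrite sz in sc.
    move: cyc'; rewrite rots /ucycle /ucycleb /=.
    case: s ss {rots} => //= a [|b s] //= _.
    rewrite rcons_path => /andP[/and4P[ea _ _ el] /and3P[_ au _]].
    case: a ea au => //= a /eqP-> {a}; move: el.
    case E: (last b s) => [l|] //= /eqP El; subst l.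
    by rewrite -E inE -in_cons mem_last.
  have [c' Ec] : exists c', c = map Some c'.
    elim: c Nc {sc cyc} => [|[a|] c IH] //; first by exists [::].
    by rewrite inE /= => /IH[c' ->]; exists (a :: c').
  move: cyc (eacyc c'); rewrite Ec in sc *; rewrite size_map in sc.
  rewrite /ucycleb cycle_map map_inj_uniq; last by move=> ? ? [].
  by move=> cyc /(_ sc); rewrite -[X in ~~ X]/(path.cycle e c' && uniq c') cyc.
Qed.

End AddLeaf.

(** Each bag becomes a leaf attached to a node of its witness, or to an arbitrary node if the
    witness is [fset0]. A tree has at least one node, so the empty list yields a node with bag
    [fset0]. *)
Lemma rip_tree (T : choiceType) (bs : seq {fset T}) :
  rip bs ->
  exists (N : finType) (e : rel N) (bag : N -> {fset T}),
    [/\ is_tree e, forall n, bag n \in fset0 :: bs,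
        forall b, b \in bs -> exists n, bag n = b
      & forall v n m, v \in bag n -> v \in bag m ->
          connect (induced e [set i | v \in bag i]) n m].
Proof.
elim: bs => [_|b bs IH /= [/IH[N [e [bag [treeN bagin inbag bagconn]]]] [p pbs bp]]].
  exists unit, (fun _ _ => false), (fun _ => fset0); split=> //.
  - split=> //; first by rewrite card_unit.
      by move=> [] []; apply: connect0.
    by move=> [|[] [|[] c]].
have [n0 pn0] : exists n0, forall x, x \in p -> x \in bag n0.
  move: pbs; rewrite inE => /orP[/eqP->|/inbag[n <-]]; last by exists n.
  by case: treeN => /card_gt0P[n _] _ _ _ _; exists n.
pose bag' (n : option N) := if n is Some a then bag a else b.
exists (option N), (add_leaf e n0), bag'; split.
- exact: add_leaf_tree.
- move=> [n|] /=; last by rewrite !inE eqxx orbT.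
  by move: (bagin n); rewrite !inE => /orP[]->; rewrite ?orbT.
- move=> b'; rewrite inE => /orP[/eqP->|/inbag[n <-]]; first by exists None.
  by exists (Some n).
have liftc v n m : v \in bag n -> v \in bag m ->
    connect (induced (add_leaf e n0) [set i | v \in bag' i]) (Some n) (Some m).
  move=> vn vm; apply: connect_Some (bagconn _ _ _ vn vm) => x.
  by rewrite !inE.
have vn0 v n : v \in bag n -> v \in b -> v \in bag n0.
  move=> vn vb; apply: pn0; apply: (bp (bag n)) => //.
  by move: (bagin n) vn; rewrite inE => /orP[/eqP->|//]; rewrite inE.
move=> v [n|] [m|] /= vn vm.
- exact: liftc.
- apply: connect_trans (liftc _ _ n0 vn (vn0 _ _ vn vm)) _.
  by apply: connect1; rewrite inducedE !inE /= eqxx vm (vn0 _ _ vn vm).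
- apply: (connect_trans (y := Some n0)); last exact: (liftc _ _ _ (vn0 _ _ vm vn)).
  by apply: connect1; rewrite inducedE !inE /= eqxx vn (vn0 _ _ vm vn).
- exact: connect0.
Qed.

(** A tree decomposition must also cover vertices on no edge; missing ones become singleton bags
    with witness [fset0]. *)
Lemma rip_cover (T : finType) (bs : seq {fset T}) :
  rip bs -> exists bs', [/\ rip (bs' ++ bs), forall b, b \in bs' -> #|` b| <= 1
    & forall x, exists2 b, b \in bs' ++ bs & x \in b].
Proof.
move=> ripbs.
suff [bs' [rip' sz' cov']] : exists bs', [/\ rip (bs' ++ bs),
    forall b, b \in bs' -> #|` b| <= 1
  & forall x, x \in enum T -> exists2 b, b \in bs' ++ bs & x \in b].
  by exists bs'; split=> // x; apply: cov'; rewrite mem_enum.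
elim: (enum T) => [|x s [bs' [rip' sz' cov']]]; first by exists [::].
have [[b b' xb]|nx] := pselect (exists2 b, b \in bs' ++ bs & x \in b).
  exists bs'; split=> // y; rewrite inE => /orP[/eqP->|]; last exact: cov'.
  by exists b.
exists ([fset x]%fset :: bs'); split=> /=.
- split=> //; exists fset0; rewrite ?mem_head // => b' y b'in.
  by rewrite inE => /eqP-> xb; case: nx; exists b'.
- by move=> b; rewrite inE => /orP[/eqP->|/sz'//]; rewrite cardfs1.
- move=> y; rewrite inE => /orP[/eqP->|ys].
    by exists [fset x]%fset; rewrite ?mem_head ?inE.
  by have [b bin yb] := cov' _ ys; exists b; rewrite // inE bin orbT.
Qed.

Lemma rip_treewidth (T : finType) (g : rel T) w (bs : seq {fset T}) :
  rip bs -> (forall b, b \in bs -> #|` b| <= w.+1) ->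
  (forall x y, g x y -> exists2 b, b \in bs & (x \in b) && (y \in b)) ->
  treewidth_le g w.
Proof.
move=> /rip_cover[bs' [/rip_tree[N [e [bag [treeN bagin inbag bagconn]]]]]].
move=> sz' cov' sz gcov.
exists N, e, (fun n => [set x | x \in bag n]); split; first split=> //.
- move=> v; have [b /inbag[n <-] vb] := cov' v; by exists n; rewrite inE.
- move=> u v /gcov[b bin uv]; have [|n nb] := inbag b.
    by rewrite mem_cat bin orbT.
  by exists n; rewrite !inE nb.
- move=> v n m; rewrite !inE => vn vm; have := bagconn _ _ _ vn vm.
  apply: connect_sub => i j /and3P[]; rewrite !inE => vi vj eij.
  by apply: connect1; rewrite inducedE !inE vi vj eij.
move=> n; have -> : #|[set x | x \in bag n]| = #|` bag n|.
  rewrite cardfE -(card_imset _ val_inj); apply: eq_card => x.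
  rewrite inE; apply/idP/imsetP => [xb|[y _ ->]]; last exact: valP.
  by exists [` xb]%fset.
move: (bagin n); rewrite inE mem_cat => /or3P[/eqP->|/sz'|/sz//].
  by rewrite cardfs0.
by move/leq_trans; apply.
Qed.

(** * ♯-formulas as linear combinations of pp-formulas *)

Section Atoms.
Variable tau : signature.

Definition atom (T : Type) := {R : sym tau & (arity R).-tuple T}.

HB.instance Definition _ (T : eqType) :=
  Equality.copy (atom T) {R : sym tau & (arity R).-tuple T}.

Definition mkatom T (R : sym tau) (t : (arity R).-tuple T) : atom T :=
  Tagged (fun R => (arity R).-tuple T) t.

Definition amap T T' (f : T -> T') (a : atom T) : atom T' :=
  mkatom (map_tuple f (tagged a)).

Definition avars T (a : atom T) : seq T := tval (tagged a).

Definition aholds (B : fstruct tau) T (k : T -> B) (a : atom T) : bool :=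
  map_tuple k (tagged a) \in interp B (tag a).

Lemma avars_amap T T' (f : T -> T') a : avars (amap f a) = map f (avars a).
Proof. by []. Qed.

Lemma aholds_amap (B : fstruct tau) T T' (f : T -> T') (k : T' -> B) a :
  aholds k (amap f a) = aholds (k \o f) a.
Proof.
rewrite /aholds /=; suff -> : map_tuple k (map_tuple f (tagged a)) =
  map_tuple (k \o f) (tagged a) by [].
by apply: eq_from_tnth => i; rewrite !tnth_map.
Qed.

Lemma eq_in_aholds (B : fstruct tau) (T : eqType) (k k' : T -> B) a :
  {in avars a, k =1 k'} -> aholds k a = aholds k' a.
Proof.
move=> kk'; rewrite /aholds; suff -> : map_tuple k (tagged a) =
  map_tuple k' (tagged a) by [].
by apply: eq_from_tnth => i; rewrite !tnth_map kk' ?mem_tnth.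
Qed.

End Atoms.

Lemma sum_ffun_sum (V1 V2 B : finType)
    (F : {ffun V1 -> B} -> {ffun V2 -> B} -> nat) :
  \sum_(g : {ffun V1 + V2 -> B}) F [ffun v => g (inl v)] [ffun v => g (inr v)] =
  \sum_g1 \sum_g2 F g1 g2.
Proof.
rewrite pair_big /=.
pose f (p : {ffun V1 -> B} * {ffun V2 -> B}) : {ffun V1 + V2 -> B} :=
  [ffun v => match v with inl a => p.1 a | inr b => p.2 b end].
pose f' (g : {ffun V1 + V2 -> B}) :=
  ([ffun v => g (inl v)] : {ffun V1 -> B}, [ffun v => g (inr v)] : {ffun V2 -> B}).
have fK : cancel f f'.
  by move=> [g1 g2]; congr pair; apply/ffunP => v; rewrite !ffunE.
have f'K : cancel f' f.
  by move=> g; apply/ffunP => -[v|v]; rewrite !ffunE.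
rewrite (reindex f); last by exists f' => ? _; [apply: fK | apply: f'K].
apply: eq_bigr => p _.
by rewrite -[in RHS](fK p).
Qed.

Lemma ffun_fun (V B : finType) (f : V -> B) : [ffun v => f v] = f :> (V -> B).
Proof. by apply/funext => v; rewrite ffunE. Qed.

Lemma card_imfset_le (T T' : choiceType) (f : T -> T') (b : {fset T}) :
  #|` [fset f x | x in b]%fset| <= #|` b|.
Proof. exact: leq_imfset_card. Qed.

(** * pp-formulas with named free variables and their decompositions *)

Section Terms.
Variable tau : signature.

(* A pp-formula with liberal variables [tV] and quantified variables [tW], whose
   atoms may in addition mention names ([var]) of free variables of a ♯-formula. *)
Record term := Term {
  tV : finType;
  tW : finType;
  tats : seq (atom tau ((var + tV) + tW)%type)
}.

Definition ev (B : Type) (V W : Type) (h : var -> B) (g : V -> B) (k : W -> B)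
    (x : ((var + V) + W)%type) : B :=
  match x with
  | inl (inl n) => h n
  | inl (inr v) => g v
  | inr w => k w
  end.

Definition tsat (B : fstruct tau) (h : var -> B) (t : term) (g : tV t -> B) :=
  exists k : tW t -> B, all (aholds (ev h g k)) (tats t).

Definition tcount (B : fstruct tau) (h : var -> B) (t : term) : nat :=
  \sum_(g : {ffun tV t -> B}) `[< tsat h g >].

Definition inj1 (V1 V2 W1 W2 : Type) (x : ((var + V1) + W1)%type) :
    ((var + (V1 + V2)) + (W1 + W2))%type :=
  match x with
  | inl (inl n) => inl (inl n)
  | inl (inr v) => inl (inr (inl v))
  | inr w => inr (inl w)
  end.

Definition inj2 (V1 V2 W1 W2 : Type) (x : ((var + V2) + W2)%type) :
    ((var + (V1 + V2)) + (W1 + W2))%type :=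
  match x with
  | inl (inl n) => inl (inl n)
  | inl (inr v) => inl (inr (inr v))
  | inr w => inr (inr w)
  end.

(** Conjunction with names shared and all other variables kept apart; for fixed values of the names
    the counts therefore multiply. *)
Definition tmul (t1 t2 : term) : term :=
  @Term (tV t1 + tV t2)%type (tW t1 + tW t2)%type
    (map (amap (@inj1 _ _ _ _)) (tats t1) ++ map (amap (@inj2 _ _ _ _)) (tats t2)).

Definition close_var (X : {fset var}) (V W : Type) (x : ((var + V) + W)%type) :
    ((var + (X + V)) + W)%type :=
  match x with
  | inl (inl n) => if insub n is Some v then inl (inr (inl v)) else inl (inl n)
  | inl (inr v) => inl (inr (inr v))
  | inr w => inr w
  end.

(** All of [X] becomes liberal, even names that no atom mentions: summing over such a name still
    contributes a factor |B|. *)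
Definition tclose (X : {fset var}) (t : term) : term :=
  @Term (X + tV t)%type (tW t) (map (amap (@close_var X _ _)) (tats t)).

Definition quant_var (y : var) (V W : Type) (x : ((var + V) + W)%type) :
    ((var + V) + (unit + W))%type :=
  match x with
  | inl (inl n) => if n == y then inr (inl tt) else inl (inl n)
  | inl (inr v) => inl (inr v)
  | inr w => inr (inr w)
  end.

Definition tquant (y : var) (t : term) : term :=
  @Term (tV t) (unit + tW t)%type (map (amap (@quant_var y _ _)) (tats t)).

Definition over (B : Type) (h : var -> B) (X : {fset var}) (g : X -> B) n :=
  if insub n is Some v then g v else h n.

Lemma all_aholds_map (B : fstruct tau) T T' (f : T -> T') (k : T' -> B)
    (s : seq (atom tau T)) :
  all (aholds k) (map (amap f) s) = all (aholds (k \o f)) s.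
Proof.
by rewrite all_map; apply: eq_all => a /=; rewrite aholds_amap.
Qed.

Lemma tsat_mul (B : fstruct tau) (h : var -> B) t1 t2
    (g : tV (tmul t1 t2) -> B) :
  tsat h g <-> tsat h (fun v => g (inl v)) /\ tsat h (fun v => g (inr v)).
Proof.
have E1 (k : tW (tmul t1 t2) -> B) :
    ev h g k \o @inj1 _ _ _ _ = ev h (fun v => g (inl v)) (fun w => k (inl w)).
  by apply/funext => -[[]|].
have E2 (k : tW (tmul t1 t2) -> B) :
    ev h g k \o @inj2 _ _ _ _ = ev h (fun v => g (inr v)) (fun w => k (inr w)).
  by apply/funext => -[[]|].
split=> [[k]|[[k1 k1P] [k2 k2P]]].
  rewrite all_cat !all_aholds_map E1 E2 => /andP[k1P k2P].
  by split; [exists (fun w => k (inl w)) | exists (fun w => k (inr w))].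
exists (fun w => match w with inl w => k1 w | inr w => k2 w end).
by rewrite all_cat !all_aholds_map E1 E2 k1P.
Qed.

Lemma tsat_close (B : fstruct tau) (h : var -> B) X t
    (g : tV (tclose X t) -> B) :
  tsat h g <-> tsat (over h (fun v => g (inl v))) (fun v => g (inr v)).
Proof.
have E (k : tW t -> B) :
    ev h g k \o @close_var X _ _ = ev (over h (fun v => g (inl v))) (fun v => g (inr v)) k.
  by apply/funext => -[[n|v]|w] //=; rewrite /over; case: insub.
by split=> -[k kP]; exists k; move: kP; rewrite all_aholds_map E.
Qed.

Lemma tsat_quant (B : fstruct tau) (h : var -> B) y t (g : tV t -> B) :
  @tsat B h (tquant y t) g <->
  exists b, tsat (fun n => if n == y then b else h n) g.
Proof.
have E (k : tW (tquant y t) -> B) :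
    ev h g k \o @quant_var y _ _ =
    ev (fun n => if n == y then k (inl tt) else h n) g (fun w => k (inr w)).
  by apply/funext => -[[n|v]|w] //=; case: eqP.
split=> [[k]|[b [k kP]]].
  rewrite all_aholds_map E => kP; exists (k (inl tt)).
  by exists (fun w => k (inr w)).
exists (fun w => match w with inl _ => b | inr w => k w end).
by rewrite all_aholds_map E.
Qed.

Lemma tcount_mul (B : fstruct tau) (h : var -> B) t1 t2 :
  tcount h (tmul t1 t2) = tcount h t1 * tcount h t2.
Proof.
rewrite /tcount big_distrlr /=.
rewrite -(sum_ffun_sum (fun (g1 : {ffun tV t1 -> B}) (g2 : {ffun tV t2 -> B}) =>
  (`[< tsat h g1 >] * `[< tsat h g2 >])%N)).
apply: eq_bigr => g _; rewrite mulnb; congr (nat_of_bool _).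
rewrite -asbool_and; apply: asbool_equiv_eq; rewrite tsat_mul.
by rewrite !ffun_fun.
Qed.

Lemma tcount_close (B : fstruct tau) (h : var -> B) X t :
  tcount h (tclose X t) = \sum_(g : {ffun X -> B}) tcount (over h g) t.
Proof.
rewrite /tcount.
rewrite -(sum_ffun_sum (fun (g1 : {ffun X -> B}) (g2 : {ffun tV t -> B}) =>
  (`[< tsat (over h g1) g2 >] : nat))).
apply: eq_bigr => g _; congr (nat_of_bool _).
apply: asbool_equiv_eq; rewrite tsat_close.
by rewrite !ffun_fun.
Qed.

Definition counted (s : bool) (V W : Type) (x : ((var + V) + W)%type) : bool :=
  ~~ s || (if x is inl _ then true else false).

Definition bsize (s : bool) (V W : choiceType)
    (b : {fset ((var + V) + W)%type}) : nat :=
  #|` [fset x in b | counted s x]%fset|.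

Definition labs (V W : choiceType) (L : {fset var}) :
    {fset ((var + V) + W)%type} := [fset inl (inl n) | n in L]%fset.

(* With [s = false], a tree decomposition of the graph of [t] of bag size at most
   [k]; with [s = true] only the non-quantified vertices of a bag count, but each
   quantified vertex occurs in one bag only, hence every ∃-component lies within
   one bag.  In both cases the names in [L] form a bag. *)
Definition decomposed (s : bool) (k : nat) (L : {fset var}) (t : term) : Prop :=
  exists bs : seq {fset ((var + tV t) + tW t)%type},
    [/\ rip (rcons bs (labs _ _ L)),
        forall b n, b \in bs -> inl (inl n) \in b -> n \in L,
        forall b, b \in rcons bs (labs _ _ L) -> bsize s b <= k,
        forall a, a \in tats t ->
          exists2 b : {fset _}, b \in rcons bs (labs _ _ L) &
            {subset avars a <= b}
      & s -> forall b b' w, b \in bs -> b' \in bs ->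
          inr w \in b -> inr w \in b' -> b = b'].

Lemma mem_labs (V W : choiceType) L n :
  ((inl (inl n) : ((var + V) + W)%type) \in labs V W L) = (n \in L).
Proof. by rewrite mem_imfset //= => ? ? []. Qed.

Lemma labsP (V W : choiceType) L (x : ((var + V) + W)%type) :
  x \in labs V W L -> exists2 n, n \in L & x = inl (inl n).
Proof. by move=> /imfsetP[n /= nL ->]; exists n. Qed.

Lemma bsize_labs s (V W : choiceType) L : bsize s (labs V W L) <= #|` L|.
Proof.
apply: leq_trans (card_imfset_le (fun n : var => inl (inl n) : ((var + V) + W)%type) _).
by apply: fsubset_leq_card; apply/fsubsetP => x; rewrite !inE => /andP[].
Qed.

Lemma bsize_imfset s (V W V' W' : choiceType)
    (f : ((var + V) + W)%type -> ((var + V') + W')%type) b :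
  (forall x, counted s (f x) -> counted s x) ->
  bsize s [fset f x | x in b]%fset <= bsize s b.
Proof.
move=> fs; apply: leq_trans (card_imfset_le f _).
apply: fsubset_leq_card; apply/fsubsetP => y; rewrite !inE /=.
move=> /andP[/imfsetP[x /= xb ->] /fs cx]; apply/imfsetP; exists x => //=.
by rewrite !inE /= xb.
Qed.

Lemma decomposed_labels s k L t a n :
  decomposed s k L t -> a \in tats t -> inl (inl n) \in avars a -> n \in L.
Proof.
move=> [bs [_ bL _ ats _]] /ats[b]; rewrite mem_rcons inE.
by move=> /orP[/eqP->|/bL bin] sub /sub; rewrite ?mem_labs //; apply: bin.
Qed.

Lemma decomposed_rebase s k L L' t :
  decomposed s k L t -> {subset L <= L'} -> #|` L'| <= k ->
  decomposed s k L' t.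
Proof.
move=> [bs [ripb bL bk ats buniq]] LL' L'k; exists (rcons bs (labs _ _ L)); split.
- apply: rip_rebase => // b x bin xb /labsP[n _ xn].
  by rewrite xn mem_labs (bL b) // -xn.
- move=> b n; rewrite mem_rcons inE => /orP[/eqP->|bin].
    by rewrite mem_labs; apply: LL'.
  by move/(bL _ _ bin)/LL'.
- move=> b; rewrite mem_rcons inE => /orP[/eqP->|/bk//].
  exact: leq_trans (bsize_labs _ _ _ _) L'k.
- move=> a /ats[b bin sub]; exists b => //.
  by rewrite mem_rcons inE bin orbT.
- move=> ss b b' w; rewrite !mem_rcons !inE.
  move=> /orP[/eqP->|bin] /orP[/eqP->|b'in] //.
  + by move=> /labsP[].
  + by move=> _ /labsP[].
  + exact: buniq.
Qed.

(** Common form of summing and quantifying: [f] turns the names in [X] into variables of the term,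
    and the smaller label bag is appended at the end. For [s = true] a quantified vertex may arise
    only from a quantified one, since a name may lie in many bags and would violate uniqueness. *)
Lemma decomposed_rename s k L X (V W V' W' : finType)
    (f : ((var + V) + W)%type -> ((var + V') + W')%type) ats :
  injective f -> (forall x, counted s (f x) -> counted s x) ->
  (forall n, n \notin X -> f (inl (inl n)) = inl (inl n)) ->
  (forall y n, f y = inl (inl n) -> y = inl (inl n) /\ n \notin X) ->
  (s -> forall y w, f y = inr w -> exists w', y = inr w') ->
  decomposed s k L (@Term V W ats) -> #|` (L `\` X)%fset| <= k ->
  decomposed s k (L `\` X)%fset (@Term V' W' (map (amap f) ats)).
Proof.
move=> f_inj fs fX fl fr [bs [/= ripb bL bk atsb buniq]] L'k.
exists [seq [fset f x | x in b]%fset | b : {fset _} <- rcons bs (labs _ _ L)]; split.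
- move: (rip_imfset f_inj ripb); rewrite map_rcons => /rip_rebase; apply.
  move=> _ x _ _ /labsP[n]; rewrite inE => /andP[nX nL] ->.
  by rewrite -(fX _ nX) mem_imfset //= mem_labs.
- move=> b n /mapP[b' b'in ->] /imfsetP[y /= yb] /esym/fl[yn nX].
  rewrite inE nX /=; move: b'in yb; rewrite yn mem_rcons inE.
  by move=> /orP[/eqP->|/bL]; rewrite ?mem_labs //; apply.
- move=> b; rewrite mem_rcons inE => /orP[/eqP->|/mapP[b' b'in ->]].
    exact: leq_trans (bsize_labs _ _ _ _) L'k.
  exact: leq_trans (bsize_imfset _ fs) (bk _ b'in).
- move=> a /mapP[a' /atsb[b bin sub] ->].
  exists [fset f x | x in b]%fset.
    by rewrite mem_rcons inE map_f ?orbT.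
  by move=> x; rewrite avars_amap => /mapP[y /sub yb ->]; rewrite mem_imfset.
- move=> ss b b' w /mapP[c cin ->] /mapP[c' c'in ->].
  move=> /imfsetP[y /= yc wE] /imfsetP[y' /= yc' wE'].
  have [w0 yw] := fr ss _ _ (esym wE).
  have yy : y' = y by apply: f_inj; rewrite -wE -wE'.
  subst y' y; suff -> : c = c' by []; move: cin c'in yc yc'.
  rewrite !mem_rcons !inE => /orP[/eqP->|cin] /orP[/eqP->|c'in].
  + by [].
  + by move=> /labsP[].
  + by move=> _ /labsP[].
  + exact: buniq ss _ _ _ cin c'in.
Qed.

Lemma decomposed_close s k L X t :
  decomposed s k L t -> #|` (L `\` X)%fset| <= k ->
  decomposed s k (L `\` X)%fset (tclose X t).
Proof.
case: t => V W ats; apply: decomposed_rename.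
- apply: (can_inj (g := fun x => match x with
    | inl (inl n) => inl (inl n)
    | inl (inr (inl v)) => inl (inl (val v))
    | inl (inr (inr v)) => inl (inr v)
    | inr w => inr w
    end)) => -[[n|v]|w] //=.
  by case: insubP => //= u _ ->.
- by rewrite /counted => -[[n|v]|w] //; rewrite !orbT.
- by move=> n nX /=; rewrite insubN.
- move=> [[n'|v]|w] n //=; case: insubP => // nX [<-]; by [].
- by move=> _ [[n|v]|w'] w //=; [case: insub | exists w'].
Qed.

Lemma decomposed_quant k L y t :
  decomposed false k L t -> #|` (L `\ y)%fset| <= k ->
  decomposed false k (L `\ y)%fset (tquant y t).
Proof.
case: t => V W ats; apply: decomposed_rename => //.
- apply: (can_inj (g := fun x => match x with
    | inl x => inl x
    | inr (inl _) => inl (inl y)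
    | inr (inr w) => inr w
    end)) => -[[n|v]|w] //=.
  by case: eqP => [->|].
- by move=> n; rewrite inE /= => /negPf->.
- move=> [[n'|v]|w] n //=; case: eqP => // ny [<-]; split=> //.
  by rewrite inE; apply/eqP.
Qed.

(** The renamed decompositions share only names, all of them in the label bag, so they are glued
    there. *)
Lemma decomposed_mul s k L t1 t2 :
  decomposed s k L t1 -> decomposed s k L t2 -> decomposed s k L (tmul t1 t2).
Proof.
move=> [bs1 [rip_1 bL1 bk1 ats1 u1]] [bs2 [rip_2 bL2 bk2 ats2 u2]].
pose f1 := @inj1 (tV t1) (tV t2) (tW t1) (tW t2).
pose f2 := @inj2 (tV t1) (tV t2) (tW t1) (tW t2).
have i1 : injective f1 by move=> [[?|?]|?] [[?|?]|?] //= [->].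
have i2 : injective f2 by move=> [[?|?]|?] [[?|?]|?] //= [->].
have l1 : [fset f1 x | x in labs (tV t1) (tW t1) L]%fset = labs _ _ L.
  apply/fsetP => x; apply/imfsetP/idP => [[y /labsP[n nL ->] ->]|/labsP[n nL ->]].
    by rewrite mem_labs.
  by exists (inl (inl n)); rewrite //= mem_labs.
have l2 : [fset f2 x | x in labs (tV t2) (tW t2) L]%fset = labs _ _ L.
  apply/fsetP => x; apply/imfsetP/idP => [[y /labsP[n nL ->] ->]|/labsP[n nL ->]].
    by rewrite mem_labs.
  by exists (inl (inl n)); rewrite //= mem_labs.
pose F1 (b : {fset _}) := [fset f1 x | x in b]%fset.
pose F2 (b : {fset _}) := [fset f2 x | x in b]%fset.
have E1 : rcons (map F1 bs1) (labs _ _ L) = map F1 (rcons bs1 (labs _ _ L)).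
  by rewrite map_rcons /F1 l1.
have E2 : rcons (map F2 bs2) (labs _ _ L) = map F2 (rcons bs2 (labs _ _ L)).
  by rewrite map_rcons /F2 l2.
exists (rcons (map F1 bs1) (labs _ _ L) ++ map F2 bs2).
have labin : labs _ _ L \in rcons (map F2 bs2) (labs _ _ L).
  by rewrite mem_rcons mem_head.
rewrite rcons_cat.
have memE b : b \in rcons (map F1 bs1) (labs _ _ L) ++ rcons (map F2 bs2) (labs _ _ L) ->
    (exists2 c, c \in rcons bs1 (labs _ _ L) & b = F1 c) \/
    (exists2 c, c \in rcons bs2 (labs _ _ L) & b = F2 c).
  rewrite E1 E2 mem_cat.
  by move=> /orP[] /mapP[c cin ->]; [left | right]; exists c.
split.
- apply: (rip_glue (r := labs _ _ L)).
  + by rewrite E1; apply: rip_imfset.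
  + by rewrite E2; apply: rip_imfset.
  + by rewrite inE labin orbT.
  + by move=> b x _ xL _.
  + move=> b2 b1 x /mapP[c cin ->]; rewrite E2 => /mapP[d din ->].
    move=> /imfsetP[y /= yc ->] /imfsetP[z /= zd].
    case: y yc => [[n|v]|w] yc; case: z zd => [[n'|v']|w'] //= _ _.
    by rewrite mem_labs; apply: bL1 cin yc.
- move=> b n; rewrite mem_cat mem_rcons inE -orbA => /or3P[/eqP->|/mapP[c cin ->]|/mapP[c cin ->]].
  + by rewrite mem_labs.
  + move=> /imfsetP[[[n'|v]|w] //= nc [->]]; exact: bL1 cin nc.
  + move=> /imfsetP[[[n'|v]|w] //= nc [->]]; exact: bL2 cin nc.
- move=> b /memE[[c cin ->]|[c cin ->]].
  + by apply: leq_trans (bsize_imfset _ _) (bk1 _ cin) => -[[?|?]|?].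
  + by apply: leq_trans (bsize_imfset _ _) (bk2 _ cin) => -[[?|?]|?].
- move=> a /=; rewrite mem_cat => /orP[/mapP[a' /ats1[b bin sub] ->]|/mapP[a' /ats2[b bin sub] ->]].
  + exists (F1 b); first by rewrite E1 mem_cat map_f.
    by move=> x; rewrite avars_amap => /mapP[y /sub yb ->]; rewrite (mem_imfset _ _ i1); apply: yb.
  + exists (F2 b); first by rewrite E2 mem_cat map_f ?orbT.
    by move=> x; rewrite avars_amap => /mapP[y /sub yb ->]; rewrite (mem_imfset _ _ i2); apply: yb.
- move=> ss b b' w; rewrite !mem_cat !mem_rcons !inE -!orbA.
  move=> /or3P[/eqP->|/mapP[c cin ->]|/mapP[c cin ->]] /or3P[/eqP->|/mapP[d din ->]|/mapP[d din ->]] //;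
    try by move=> /labsP[].
  + by move=> _ /labsP[].
  + move=> /imfsetP[[[?|?]|w1] //= wc [->]] /imfsetP[[[?|?]|w2] //= wd [ww]]; subst w2.
    by rewrite (u1 ss _ _ _ cin din wc wd).
  + by move=> /imfsetP[[[?|?]|w1] //= wc [->]] /imfsetP[[[?|?]|w2]].
  + by move=> _ /labsP[].
  + by move=> /imfsetP[[[?|?]|w1] //= wc [->]] /imfsetP[[[?|?]|w2]].
  + move=> /imfsetP[[[?|?]|w1] //= wc [->]] /imfsetP[[[?|?]|w2] //= wd [ww]]; subst w2.
    by rewrite (u2 ss _ _ _ cin din wc wd).
Qed.

End Terms.

Lemma bigmax_all (T : Type) (s : seq T) (F : T -> nat) k :
  (\max_(x <- s) F x <= k) = all (fun x => F x <= k) s.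
Proof.
by elim: s => [|x s IH]; rewrite ?big_nil // big_cons geq_max IH.
Qed.

(** * Expansion of ♯PP-formulas into terms *)

Section Expansion.
Variable tau : signature.
Implicit Types (p q : fo tau) (psi : sharp tau).

Definition fo_bound (k : nat) p : bool :=
  all (fun q => #|` fo_free q| <= k) (fo_sub p).

Definition sharp_bound (s : bool) (k : nat) psi : bool :=
  all (fun theta => #|` sharp_free theta| <= k) (sharp_sub psi) &&
  (s || all (fun q => #|` fo_free q| <= k) (sharp_fo_sub psi)).

Lemma sharp_widthE psi k : (sharp_width psi <= k) = sharp_bound true k psi.
Proof. by rewrite /sharp_bound andbT -bigmax_all. Qed.

Lemma widthE psi k : (width psi <= k) = sharp_bound false k psi.
Proof. by rewrite /sharp_bound geq_max !bigmax_all. Qed.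

Lemma fo_bound_sub k p : fo_bound k p -> #|` fo_free p| <= k.
Proof. by rewrite /fo_bound; case: p => [R a|p|p q|p q|x p|x p] /= /andP[]. Qed.

Lemma sharp_bound_free s k psi : sharp_bound s k psi -> #|` sharp_free psi| <= k.
Proof.
rewrite /sharp_bound => /andP[+ _].
by case: psi => [p L|X psi|X psi|psi psi'|psi psi'|n] //= /andP[].
Qed.

(** The term does not depend on [k], so it is available however large the fo-subformulas are. Terms
    are evaluated under total maps, whence the pair of [h] and [h0] agreeing on the free
    variables. *)
Lemma pp_term p :
  is_pp p -> exists t : term tau,
    [/\ #|tV t| = 0,
        forall k, fo_bound k p -> decomposed false k (fo_free p) t
      & forall (B : fstruct tau) (h : assignment B) (h0 : var -> B) (g : tV t -> B),
          (forall x, x \in fo_free p -> h x = Some (h0 x)) ->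
          (sat h p <-> tsat h0 g)].
Proof.
elim: p => [R args|//|p IHp q IHq|//|x p IHp|//] /=.
- move=> _; pose a := mkatom (map_tuple (fun n => inl (inl n) : (var + void + void)%type) args).
  exists (@Term tau void void [:: a]); split=> /=; first by rewrite card_void.
    move=> k /fo_bound_sub /= Lk; exists [::]; split=> //=; first exact: rip1.
      move=> b; rewrite inE => /eqP->; exact: leq_trans (bsize_labs _ _ _ _) Lk.
    move=> b; rewrite inE => /eqP->; exists (labs void void (fo_free (FAtom args))).
      by rewrite mem_head.
    by move=> y /mapP[n nargs ->]; rewrite mem_labs inE.
  move=> B h h0 g hh0; have hE : map h args = map Some (map h0 args).
    by rewrite -map_comp; apply/eq_in_map => n nargs /=; apply: hh0; rewrite inE.
  have aE (k : void -> B) : aholds (ev h0 g k) a = (map_tuple h0 args \in interp B R).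
    rewrite /aholds /=; suff -> : map_tuple (ev h0 g k) (map_tuple (fun n => inl (inl n)) args)
      = map_tuple h0 args by [].
    by apply: eq_from_tnth => i; rewrite !tnth_map.
  split=> [/existsP[u /andP[uR]]|[k]].
    rewrite hE inj_eq; last by apply: inj_map => ? ? [].
    move=> /eqP uE; exists (fun v : void => match v with end) => /=.
    rewrite andbT aE; suff -> : map_tuple h0 args = u by [].
    exact: val_inj.
  rewrite /= andbT aE => hR; apply/existsP; exists (map_tuple h0 args).
  by rewrite hR hE eqxx.
- move=> /andP[/IHp[t1 [V1 dec1 sat1]] /IHq[t2 [V2 dec2 sat2]]].
  exists (tmul t1 t2); split.
  + by rewrite card_sum V1 V2.
  + move=> k /[dup] /fo_bound_sub /= Lk.
    rewrite /fo_bound /= all_cat => /and3P[_ /dec1 d1 /dec2 d2].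
    apply: decomposed_mul.
      by apply: decomposed_rebase d1 _ Lk => x; rewrite inE => ->.
    by apply: decomposed_rebase d2 _ Lk => x; rewrite inE orbC => ->.
  + move=> B h h0 g hh0; rewrite tsat_mul.
    rewrite -(sat1 B h h0); last by move=> x xp; apply: hh0; rewrite inE xp.
    rewrite -(sat2 B h h0); last by move=> x xp; apply: hh0; rewrite inE xp orbT.
    by split=> [/andP//|[-> ->]].
- move=> /IHp[t [Vt dec satt]]; exists (tquant x t); split=> //.
  + move=> k /[dup] /fo_bound_sub /= Lk; rewrite /fo_bound /= => /andP[_ /dec d].
    exact: decomposed_quant.
  + move=> B h h0 g hh0; rewrite tsat_quant.
    have E b : sat (update h x b) p <->
        tsat (fun n => if n == x then b else h0 n) (g : tV t -> B).
      apply: satt => y yp; rewrite /update; case: eqP => // /eqP yx.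
      by apply: hh0; rewrite !inE yx.
    split=> [/existsP[b /E]|[b /E sb]]; first by exists b.
    by apply/existsP; exists b.
Qed.

(** One bag with the names and all quantified variables suffices: only the names count. The bound
    [k'] may be arbitrarily large; the given decomposition only ensures that all names in atoms come
    from [L']. *)
Lemma decomposed_strict k k' L L' (t : term tau) :
  #|tV t| = 0 -> decomposed false k' L' t -> {subset L' <= L} -> #|` L| <= k ->
  decomposed true k L t.
Proof.
move=> Vt dec LL Lk.
pose W := [fset (inr w : (var + tV t + tW t)%type) | w in tW t]%fset.
pose b0 := (labs (tV t) (tW t) L `|` W)%fset.
have Wb w : (inr w : (var + tV t + tW t)%type) \in b0.
  by rewrite inE; apply/orP; right; apply/imfsetP; exists w.
exists [:: b0]; split=> /=.
- split; first exact: rip1.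
  exists (labs _ _ L); first by rewrite !inE eqxx orbT.
  by move=> b' x; rewrite inE => /eqP->.
- move=> b n; rewrite inE => /eqP->; rewrite inE mem_labs => /orP[//|].
  by move=> /imfsetP[].
- move=> b; rewrite !inE => /orP[] /eqP->; last exact: leq_trans (bsize_labs _ _ _ _) Lk.
  apply: leq_trans (leq_trans (bsize_labs true (tV t) (tW t) L) Lk).
  apply: fsubset_leq_card; apply/fsubsetP => x; rewrite !inE /= => /andP[].
  by move=> /orP[-> //|/imfsetP[w _ ->]].
- move=> a ain; exists b0; first by rewrite mem_head.
  move=> [[n|v]|w] // xa.
    by rewrite inE mem_labs LL // (decomposed_labels dec ain xa).
  by have := fintype0 v; rewrite Vt.
- by move=> _ b b' w; rewrite !inE => /eqP-> /eqP->.
Qed.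

Lemma tcount_tsat (B : fstruct tau) (h : var -> B) (t : term tau) (b : bool) :
  #|tV t| = 0 -> (forall g : tV t -> B, b <-> tsat h g) -> tcount h t = b.
Proof.
move=> Vt bt; rewrite /tcount (eq_bigr (fun=> nat_of_bool b)).
  by rewrite sum_nat_const card_ffun Vt expn0 mul1n.
by move=> g _; congr nat_of_bool; apply/asboolP/idP => /bt.
Qed.

(** Products distribute over the two index sets, sums take their disjoint union, and [SE] merely
    enlarges the label set. The terms are fixed before [s] and [k], so one family carries all
    decompositions. *)
Lemma sharp_terms psi :
  is_sharpPP psi -> sharp_wf psi ->
  exists (I : finType) (c : I -> int) (t : I -> term tau),
    (forall i s k, sharp_bound s k psi -> decomposed s k (sharp_free psi) (t i)) /\
    forall (B : fstruct tau) (h : assignment B) (h0 : var -> B),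
      (forall x, x \in sharp_free psi -> h x = Some (h0 x)) ->
      sharp_eval psi h = (\sum_i c i * (tcount h0 (t i))%:Z)%R.
Proof.
elim: psi => [p L|X psi IH|X psi IH|psi1 IH1 psi2 IH2|psi1 IH1 psi2 IH2|n] /=.
- move=> /pp_term[t [Vt dec satt]] /fsubsetP pL.
  exists unit, (fun=> 1%R), (fun=> t); split=> [_ s k|B h h0 hh0].
    move=> /[dup] /sharp_bound_free /= Lk; rewrite /sharp_bound /=.
    case: s => /andP[_ /= fob].
      (* The ♯-width says nothing about the fo-subformulas of [p], so their actual maximum serves as
         the auxiliary bound. *)
      apply: (decomposed_strict Vt (dec (\max_(q <- fo_sub p) #|` fo_free q|) _) pL Lk).
      by rewrite /fo_bound -bigmax_all.
    exact: decomposed_rebase (dec _ fob) pL Lk.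
  rewrite big_const card_unit /= GRing.addr0 GRing.mul1r.
  rewrite (tcount_tsat (b := sat h p) Vt); first by case: sat.
  by move=> g; apply: satt => x /pL; apply: hh0.
- move=> pp /andP[wf disj]; have [I [c [t [dec ev]]]] := IH pp wf.
  exists I, c, (fun i => tclose X (t i)); split=> [i s k|B h h0 hh0].
    move=> /[dup] /sharp_bound_free /= Lk; rewrite /sharp_bound /= -andbA.
    by move=> /andP[_ /(dec i) d]; apply: decomposed_close.
  rewrite (eq_bigr (fun g : {ffun X -> B} =>
      \sum_i c i * (tcount (over h0 g) (t i))%:Z)%R).
    rewrite exchange_big /=; apply: eq_bigr => i _.
    rewrite tcount_close -GRing.mulr_sumr; congr (_ * _)%R.
    by rewrite (big_morph Posz PoszD (erefl _)).
  move=> g _; apply: ev => x xf; rewrite /override /over.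
  by case: insubP => // nX; apply: hh0; rewrite inE nX.
- move=> pp /and3P[wf disjf disjc]; have [I [c [t [dec ev]]]] := IH pp wf.
  exists I, c, t; split=> [i s k|B h h0 hh0].
    move=> /[dup] /sharp_bound_free /= Lk; rewrite /sharp_bound /= -andbA.
    move=> /andP[_ /(dec i) d]; apply: decomposed_rebase d _ Lk => x xf.
    by rewrite inE xf orbT.
  by apply: ev => x xf; rewrite /restrict xf; apply: hh0; rewrite inE xf orbT.
- move=> /andP[pp1 pp2] /and4P[wf1 wf2 /eqP fE _].
  have [I1 [c1 [t1 [dec1 ev1]]]] := IH1 pp1 wf1.
  have [I2 [c2 [t2 [dec2 ev2]]]] := IH2 pp2 wf2.
  exists (I1 * I2)%type, (fun i => c1 i.1 * c2 i.2)%R, (fun i => tmul (t1 i.1) (t2 i.2)).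
  split=> [i s k|B h h0 hh0].
    rewrite /sharp_bound /= !all_cat => /andP[/and3P[_ b1 b2] bf].
    apply: decomposed_mul; first by apply: dec1; rewrite /sharp_bound b1; case: s bf => // /andP[].
    by rewrite fE; apply: dec2; rewrite /sharp_bound b2; case: s bf => // /andP[].
  rewrite (ev1 _ _ h0) // (ev2 _ _ h0); last by rewrite -fE.
  rewrite GRing.mulr_suml -(pair_bigA _ (fun i j =>
    c1 i * c2 j * (tcount h0 (tmul (t1 i) (t2 j)))%:Z)%R) /=.
  apply: eq_bigr => i _; rewrite GRing.mulr_sumr; apply: eq_bigr => j _.
  by rewrite tcount_mul PoszM GRing.mulrACA.
- move=> /andP[pp1 pp2] /and3P[wf1 wf2 /eqP fE].
  have [I1 [c1 [t1 [dec1 ev1]]]] := IH1 pp1 wf1.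
  have [I2 [c2 [t2 [dec2 ev2]]]] := IH2 pp2 wf2.
  exists (I1 + I2)%type, (fun i => match i with inl i => c1 i | inr i => c2 i end),
    (fun i => match i with inl i => t1 i | inr i => t2 i end).
  split=> [i s k|B h h0 hh0].
    rewrite /sharp_bound /= !all_cat => /andP[/and3P[_ b1 b2] bf].
    case: i => i; first by apply: dec1; rewrite /sharp_bound b1; case: s bf => // /andP[].
    by rewrite fE; apply: dec2; rewrite /sharp_bound b2; case: s bf => // /andP[].
  rewrite (ev1 _ _ h0) // (ev2 _ _ h0); last by rewrite -fE.
  by rewrite big_sumType.
- move=> _ _; exists unit, (fun=> n), (fun=> @Term tau void void [::]).
  split=> [_ s k _|B h h0 _].
    exists [::]; split=> //=; first exact: rip1.
    move=> b; rewrite inE => /eqP->; apply: leq_trans (bsize_labs _ _ _ _) _.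
    by rewrite cardfs0.
  rewrite big_const card_unit /= GRing.addr0 (tcount_tsat (b := true)) ?card_void ?GRing.mulr1 //.
  by move=> g; split=> // _; exists (fun v : void => match v with end).
Qed.

End Expansion.

(** * Counting functions of pp-formulas *)

Section Independence.
Local Open Scope ring_scope.
Import GRing.Theory.

(** If [y] separates [chi i] from [chi0], subtracting [chi i y] times the relation at [x] from the
    relation at [mul x y] removes [chi i]. The factor [d] collects the differences, avoiding
    division; it stays nonzero because integers have no zero divisors. *)
Lemma multiplicative_independence (X : Type) (mul : X -> X -> X) (I : Type)
    (chi0 : X -> int) (chi : I -> X -> int) (x0 : X) (d : int) (s : seq I)
    (c : I -> int) :
  (forall x y, chi0 (mul x y) = chi0 x * chi0 y) ->
  (forall i x y, chi i (mul x y) = chi i x * chi i y) ->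
  chi0 x0 != 0 -> d != 0 ->
  (forall x, d * chi0 x = \sum_(i <- s) c i * chi i x) ->
  exists i, forall x, chi i x = chi0 x.
Proof.
move=> mul0 mulI chi00; elim: s d c => [|i s IH] d c d0 dE.
  by have := dE x0; rewrite big_nil => /eqP; rewrite mulf_eq0 (negPf d0) (negPf chi00).
have [iE|/existsNP[y yE]] := pselect (forall x, chi i x = chi0 x); first by exists i.
apply: (IH (d * (chi0 y - chi i y)) (fun j => c j * (chi j y - chi i y))).
  by rewrite mulf_neq0 // subr_eq0; apply/eqP => /esym.
move=> x; have E1 := dE (mul x y); have E2 := dE x.
have -> : d * (chi0 y - chi i y) * chi0 x = d * chi0 (mul x y) - d * chi0 x * chi i y.
  by rewrite mul0; ring.
rewrite E1 E2 !big_cons mulrDl opprD addrACA mulI.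
have -> : c i * (chi i x * chi i y) - c i * chi i x * chi i y = 0 by ring.
rewrite add0r mulr_suml -sumrB; apply: eq_bigr => j _.
by rewrite mulI; ring.
Qed.

Lemma PoszX (m k : nat) : (m ^ k)%N%:Z = m%:Z ^+ k.
Proof. by elim: k => // k IH; rewrite expnS PoszM IH exprS. Qed.

(** Only positive arguments are compared, as every element of a blow-up has at least one copy. *)
Lemma int_poly_eq (P Q : {poly int}) :
  (forall n : nat, P.[n.+1%:Z] = Q.[n.+1%:Z]) -> P = Q.
Proof.
move=> PQ; apply/eqP; rewrite -subr_eq0; apply/negPn/negP => PQ0.
have := max_poly_roots PQ0 (rs := [seq n.+1%:Z | n <- iota 0 (size (P - Q))]).
rewrite size_map size_iota ltnn => H; suff : false by []; apply: H.
  by apply/allP => _ /mapP[n _ ->]; rewrite /root hornerD hornerN PQ subrr.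
by rewrite map_inj_uniq ?iota_uniq // => m n [].
Qed.

End Independence.

Lemma card_tag_fiber (B : finType) (m : B -> nat) b :
  #|[pred x : {b : B & 'I_(m b)} | tag x == b]| = m b.
Proof.
rewrite -sum1_card; transitivity (\sum_(i | i == b) \sum_(j < m i) 1).
  by rewrite sig_big_dep; apply: eq_bigl => x; rewrite andbT.
by rewrite big_pred1_eq sum1_card card_ord.
Qed.

(** * Products, blow-ups and answers with prescribed image *)

Section Queries.
Variable tau : signature.
Implicit Types A B C : fstruct tau.

(** The liberal variables are given by a map [iota] instead of a subset, so that pp-formulas and
    terms become instances of one notion. *)
Definition extends A (S : finType) (iota : S -> A) B (f : S -> B) : Prop :=
  exists h : A -> B, is_hom h /\ forall s, h (iota s) = f s.

Definition ext_set A (S : finType) (iota : S -> A) B : {set {ffun S -> B}} :=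
  [set f : {ffun S -> B} | `[< extends iota f >]].

Lemma is_hom_comp A B C (g : B -> C) (f : A -> B) :
  is_hom g -> is_hom f -> is_hom (g \o f).
Proof.
move=> gh fh R t /fh /gh; suff -> : map_tuple g (map_tuple f t) = map_tuple (g \o f) t by [].
by apply: eq_from_tnth => i; rewrite !tnth_map.
Qed.

Lemma is_hom_iter A (g : A -> A) n : is_hom g -> is_hom (iter n g).
Proof.
move=> gh; elim: n => [|n IH] /=.
  move=> R t tR; suff -> : map_tuple (iter 0 g) t = t by [].
  by apply: eq_from_tnth => i; rewrite tnth_map.
exact: (is_hom_comp gh IH).
Qed.

Definition prod_struct B C : fstruct tau :=
  @FStruct tau (B * C)%type (fun R =>
    [set t | (map_tuple fst t \in interp B R) && (map_tuple snd t \in interp C R)]).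

Lemma hom_prod A B C (h : A -> prod_struct B C) :
  is_hom h <-> is_hom (fun a => (h a).1) /\ is_hom (fun a => (h a).2).
Proof.
have E1 R (t : (arity R).-tuple A) :
    map_tuple fst (map_tuple h t) = map_tuple (fun a => (h a).1) t.
  by apply: eq_from_tnth => i; rewrite !tnth_map.
have E2 R (t : (arity R).-tuple A) :
    map_tuple snd (map_tuple h t) = map_tuple (fun a => (h a).2) t.
  by apply: eq_from_tnth => i; rewrite !tnth_map.
split=> [hh|[h1 h2] R t tR]; last by rewrite inE E1 E2 h1 ?h2.
by split=> R t /hh; rewrite inE E1 E2 => /andP[].
Qed.

Lemma card_ext_prod A (S : finType) (iota : S -> A) B C :
  #|ext_set iota (prod_struct B C)| = #|ext_set iota B| * #|ext_set iota C|.
Proof.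
rewrite -cardsX.
pose pr (f : {ffun S -> prod_struct B C}) : {ffun S -> B} * {ffun S -> C} :=
  ([ffun s => (f s).1], [ffun s => (f s).2]).
have pr_inj : injective pr.
  move=> f g [/ffunP f1 /ffunP f2]; apply/ffunP => s.
  have := f1 s; have := f2 s; rewrite !ffunE.
  by case: (f s) (g s) => [? ?] [? ?] /= -> ->.
rewrite -(card_imset _ pr_inj); apply: eq_card => -[f1 f2].
apply/imsetP/idP => [[f]|].
  rewrite inE => /asboolP[h [/hom_prod[h1 h2] hf]] [-> ->].
  rewrite inE /= !inE; apply/andP; split; apply/asboolP.
    by exists (fun a => (h a).1); split=> // s; rewrite hf ffunE.
  by exists (fun a => (h a).2); split=> // s; rewrite hf ffunE.
rewrite inE /= !inE => /andP[/asboolP[h1 [hh1 hf1]] /asboolP[h2 [hh2 hf2]]].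
exists ([ffun s => (f1 s, f2 s)] : {ffun S -> prod_struct B C}).
  rewrite inE; apply/asboolP; exists (fun a => (h1 a, h2 a) : prod_struct B C); split.
    exact/hom_prod.
  by move=> s; rewrite ffunE hf1 hf2.
by congr pair; apply/ffunP => s; rewrite !ffunE.
Qed.

(** With one point it makes every count 1, hence nonzero; with two points the count 2^|S| reveals
    the number of liberal variables. *)
Definition full_struct (T : finType) : fstruct tau :=
  @FStruct tau T (fun R => [set: (arity R).-tuple T]).

Lemma extend_along (A S : finType) (iota : S -> A) (B : Type) (f : S -> B) (h : A -> B) :
  injective iota -> exists h' : A -> B, (forall s, h' (iota s) = f s) /\
    forall a, (forall s, iota s != a) -> h' a = h a.
Proof.
move=> iota_inj; exists (fun a => if [pick s | iota s == a] is Some s then f s else h a).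
split=> [s|a na]; case: pickP => [s' /eqP E|N] //; first by rewrite (iota_inj _ _ E).
  by have := N s; rewrite eqxx.
by have := na s'; rewrite E eqxx.
Qed.

Lemma card_ext_full A (S : finType) (iota : S -> A) (T : finType) :
  injective iota -> 0 < #|T| -> #|ext_set iota (full_struct T)| = #|T| ^ #|S|.
Proof.
move=> iota_inj /card_gt0P[x _]; rewrite -card_ffun -cardsT; apply: eq_card => f.
rewrite !inE; apply/asboolP.
have [h [hf _]] := @extend_along _ _ _ (full_struct T) f (fun=> x) iota_inj.
by exists h; split=> // R t _; rewrite inE.
Qed.

Definition blow_up B (m : B -> nat) : fstruct tau :=
  @FStruct tau {b : B & 'I_(m b)} (fun R => [set t | map_tuple tag t \in interp B R]).

Lemma hom_blow_up A B (m : B -> nat) (h : A -> blow_up m) :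
  is_hom h <-> is_hom (fun a => tag (h a)).
Proof.
have E R (t : (arity R).-tuple A) :
    map_tuple tag (map_tuple h t) = map_tuple (fun a => tag (h a)) t.
  by apply: eq_from_tnth => i; rewrite !tnth_map.
by split=> hh R t /hh; rewrite inE E.
Qed.

Lemma extends_blow_up A (S : finType) (iota : S -> A) B (m : B -> nat)
    (f : S -> blow_up m) : injective iota -> (forall b, 0 < m b) ->
  extends iota f <-> extends iota (fun s => tag (f s)).
Proof.
move=> iota_inj m0; split=> -[h [hh hf]].
  by exists (fun a => tag (h a)); split=> [|s]; [exact/hom_blow_up | rewrite hf].
(* Any lift of a homomorphism to the blow-up is one; off the liberal variables the first copy is
   taken. *)
have [h' [h'f h'h]] := @extend_along _ _ _ (blow_up m) f
  (fun a => Tagged (fun b => 'I_(m b)) (Ordinal (m0 (h a)))) iota_inj.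
exists h'; split=> //; apply/hom_blow_up; suff -> : (fun a => tag (h' a)) = h by [].
apply/funext => a; have [[s <-]|na] := pselect (exists s, iota s = a).
  by rewrite h'f hf.
by rewrite h'h // => s; apply/eqP => sa; case: na; exists s.
Qed.

(** Each answer over [B] lifts by choosing a copy of [f s] independently for every [s]. *)
Lemma card_ext_blow_up A (S : finType) (iota : S -> A) B (m : B -> nat) :
  injective iota -> (forall b, 0 < m b) ->
  #|ext_set iota (blow_up m)| = \sum_(f in ext_set iota B) \prod_s m (f s).
Proof.
move=> iota_inj m0.
pose tg (f : {ffun S -> blow_up m}) : {ffun S -> B} := [ffun s => tag (f s)].
rewrite -sum1_card (partition_big tg (mem (ext_set iota B))) /=; last first.
  move=> f; rewrite !inE => /asboolP/(extends_blow_up _ iota_inj m0) ef.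
  by apply/asboolP; rewrite /tg ffun_fun.
apply: eq_bigr => f; rewrite inE => /asboolP fB.
rewrite sum1_card.
transitivity #|family (fun s => [pred x : blow_up m | tag x == f s])|.
  apply: eq_card => g; rewrite unfold_in /= inE.
  apply/andP/familyP => [[_ /eqP <-] s|gf]; first by rewrite inE ffunE.
  have gE : tg g = f by apply/ffunP => s; rewrite ffunE; apply/eqP/gf.
  rewrite gE; split=> //; apply/asboolP/(extends_blow_up _ iota_inj m0).
  by rewrite -(ffun_fun (fun s => tag (g s))) -/(tg g) gE.
rewrite card_family foldrE big_map big_enum /=; apply: eq_bigr => s _.
exact: card_tag_fiber.
Qed.

Definition ext_image A (S : finType) (iota : S -> A) B (T : {set B}) :=
  [set f in ext_set iota B | [set f s | s : S] == T].

Definition ext_within A (S : finType) (iota : S -> A) B (T : {set B}) :=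
  [set f in ext_set iota B | [set f s | s : S] \subset T].

(** With [n.+1] copies of each element of [T] and one of every other, an answer contributes [n.+1]
    to the power of the number of liberal variables it sends into [T]. The coefficient of degree |S|
    hence counts the answers inside [T]. *)
Lemma ext_within_poly A (S : finType) (iota : S -> A) B (T : {set B}) (n : nat) :
  injective iota ->
  ((#|ext_set iota (blow_up (fun b => if b \in T then n.+1 else 1))|%:Z)%R =
   (\sum_(f in ext_set iota B) 'X^#|[set s | f s \in T]| : {poly int}).[n.+1%:Z])%R.
Proof.
move=> iota_inj; rewrite card_ext_blow_up //; last by move=> b; case: ifP.
rewrite (big_morph Posz PoszD (erefl _)) horner_sum; apply: eq_bigr => f _.
rewrite hornerXn -big_mkcond /= prod_nat_const PoszX cardsE.
by congr (_ ^+ _)%R; apply: eq_card => x; rewrite inE.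
Qed.

Lemma coef_ext_within A (S : finType) (iota : S -> A) B (T : {set B}) :
  ((\sum_(f in ext_set iota B) 'X^#|[set s | f s \in T]| : {poly int})`_#|S| =
   #|ext_within iota T|%:Z)%R.
Proof.
rewrite coef_sum -sum1_card (big_morph Posz PoszD (erefl _)).
rewrite [RHS](eq_bigl (fun f => (f \in ext_set iota B) &&
  (#|S| == #|[set s | f s \in T]|))); last first.
  move=> f; rewrite !inE; congr andb; rewrite -cardsT.
  have -> : (#|[set: S]| == #|[set s | f s \in T]|) = ([set s | f s \in T] == setT).
    by rewrite eqEcard subsetT /= eqn_leq [X in _ && X]subset_leq_card ?subsetT ?andbT.
  apply/subsetP/eqP => [fT|fT _ /imsetP[s _ ->]].
    by apply/setP => s; rewrite !inE fT ?imset_f.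
  by have := in_setT s; rewrite -fT inE.
rewrite big_mkcondr; apply: eq_bigr => f _; rewrite coefXn.
by case: eqP.
Qed.

(** The equality of |S1| and |S2| comes first: it ensures that the coefficients compared have the
    same degree. *)
Lemma count_equiv_within A1 (S1 : finType) (i1 : S1 -> A1)
    A2 (S2 : finType) (i2 : S2 -> A2) :
  injective i1 -> injective i2 ->
  (forall B, 0 < #|B| -> #|ext_set i1 B| = #|ext_set i2 B|) ->
  #|S1| = #|S2| /\
  forall B (T : {set B}), 0 < #|B| -> #|ext_within i1 T| = #|ext_within i2 T|.
Proof.
move=> inj1 inj2 eqc.
have cS : #|S1| = #|S2|.
  have := eqc (full_struct bool); rewrite !card_ext_full ?card_bool // => /(_ isT).
  exact: (expnI (isT : 1 < 2)).
split=> // B T /card_gt0P[b0 _]; apply/eqP; rewrite -eqz_nat -!coef_ext_within cS.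
apply/eqP; congr (nth 0%R (polyseq _) _); apply: int_poly_eq => n.
rewrite -!ext_within_poly // eqc //; apply/card_gt0P.
have m0 : 0 < (if b0 \in T then n.+1 else 1) by case: ifP.
by exists (Tagged (fun b => 'I_(if b \in T then n.+1 else 1)) (Ordinal m0)).
Qed.

Lemma card_ext_within_sum A (S : finType) (iota : S -> A) B (T : {set B}) :
  #|ext_within iota T| = \sum_(T' : {set B} | T' \subset T) #|ext_image iota T'|.
Proof.
rewrite -sum1_card (partition_big (fun f : {ffun S -> B} => [set f s | s : S])
  (fun T' => T' \subset T)) /=; last by move=> f; rewrite inE => /andP[].
apply: eq_bigr => T' sT; rewrite -sum1_card; apply: eq_bigl => f.
by rewrite !inE -andbA; congr andb; case: eqP => [->|]; rewrite ?sT ?andbF.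
Qed.

(** Inclusion-exclusion as strong induction on |T|: answers inside [T] split by their image, and
    proper subsets already agree. *)
Lemma count_equiv_image A1 (S1 : finType) (i1 : S1 -> A1)
    A2 (S2 : finType) (i2 : S2 -> A2) B (T : {set B}) :
  (forall T : {set B}, #|ext_within i1 T| = #|ext_within i2 T|) ->
  #|ext_image i1 T| = #|ext_image i2 T|.
Proof.
move=> eqw; have [n] := ubnP #|T|; elim: n T => // n IH T; rewrite ltnS => Tn.
have := eqw T; rewrite !card_ext_within_sum (bigD1 T) //= [in RHS](bigD1 T) //=.
rewrite (eq_bigr (fun T' => #|ext_image i2 T'|)); first by move/addIn.
move=> T' /andP[sT nT]; apply: IH; apply: leq_trans Tn.
by apply: proper_card; rewrite properEneq nT.
Qed.

(** Over [A2] itself the identity yields an answer to the second query whose image is the set of its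
    liberal variables; so the first query has an answer with that image. *)
Lemma count_equiv_hom A1 (S1 : finType) (i1 : S1 -> A1)
    A2 (S2 : finType) (i2 : S2 -> A2) :
  injective i1 -> injective i2 -> 0 < #|A2| ->
  (forall B, 0 < #|B| -> #|ext_set i1 B| = #|ext_set i2 B|) ->
  exists h : A1 -> A2, is_hom h /\ [set h (i1 s) | s : S1] = [set i2 s | s : S2].
Proof.
move=> inj1 inj2 A20 /(count_equiv_within inj1 inj2)[_ eqw].
have : 0 < #|ext_image i2 [set i2 s | s : S2]|.
  apply/card_gt0P; exists [ffun s => i2 s]; rewrite !inE; apply/andP; split.
    apply/asboolP; exists id; split; last by move=> s; rewrite ffunE.
    move=> R t tR; suff -> : map_tuple id t = t by [].
    by apply: eq_from_tnth => i; rewrite tnth_map.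
  by apply/eqP/eq_imset => s; rewrite ffunE.
rewrite -(@count_equiv_image _ _ i1) => [/card_gt0P[f]|T]; last exact: eqw.
rewrite !inE => /andP[/asboolP[h [hh hf]] /eqP fE].
by exists h; split=> //; rewrite -fE; apply: eq_imset.
Qed.

End Queries.

(** * Cores embed into counting-equivalent formulas *)

(** The bound is on preimages of bags: with [s = true] a bag may contain many quantified vertices
    that are not images of liberal variables. *)
Lemma rip_treewidth_embed (T : finType) (K : choiceType) (e : T -> K) (g : rel T)
    w (bs : seq {fset K}) :
  rip bs -> (forall b, b \in bs -> #|[set x | e x \in b]| <= w.+1) ->
  (forall x y, g x y -> exists2 b, b \in bs & (e x \in b) && (e y \in b)) ->
  treewidth_le g w.
Proof.
move=> ripb szb gb.
pose pre (b : {fset K}) := [fset x in enum T | e x \in b]%fset.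
have preE x b : (x \in pre b) = (e x \in b) by rewrite !inE /= mem_enum.
apply: (@rip_treewidth _ _ _ (map pre bs)).
- by apply: rip_map ripb => x b _; exists (e x) => b'; rewrite preE.
- move=> _ /mapP[b /szb bw ->]; apply: leq_trans bw.
  rewrite cardfE -(card_imset _ val_inj); apply: subset_leq_card.
  by apply/subsetP => _ /imsetP[x _ ->]; rewrite inE -preE (valP x).
- by move=> x y /gb[b bin xy]; exists (pre b); rewrite ?map_f // !preE.
Qed.

Lemma card_preim_fset (T : finType) (K : choiceType) (e : T -> K) (b : {fset K}) :
  injective e -> #|[set x | e x \in b]| <= #|` b|.
Proof.
move=> e_inj; rewrite cardE -(size_map e); apply: uniq_leq_size.
  by rewrite map_inj_uniq ?enum_uniq.
by move=> _ /mapP[x + ->]; rewrite mem_enum inE.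
Qed.

Section TermStructure.
Variables (tau : signature) (t : term tau).

(* The padding element [None] keeps the universe non-empty; its image under the
   embedding below is irrelevant since sentences have no named variables. *)
Definition temb (u : option (tV t + tW t)) : ((var + tV t) + tW t)%type :=
  match u with
  | None => inl (inl 0)
  | Some (inl v) => inl (inr v)
  | Some (inr w) => inr w
  end.

Definition tunemb (x : ((var + tV t) + tW t)%type) : option (tV t + tW t) :=
  match x with
  | inl (inl _) => None
  | inl (inr v) => Some (inl v)
  | inr w => Some (inr w)
  end.

Definition tstruct : fstruct tau :=
  @FStruct tau (option (tV t + tW t))
    (fun R => [set u | mkatom (map_tuple temb u) \in tats t]).

Definition tiota (v : tV t) : tstruct := Some (inl v).

Lemma temb_inj : injective temb.
Proof. by apply: (can_inj (g := tunemb)) => -[[v|w]|]. Qed.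

Lemma tiota_inj : injective tiota.
Proof. by move=> v v' []. Qed.

(** A decomposition with empty label set guarantees that no atom mentions a name, so [tstruct]
    captures all atoms and [h] is irrelevant. *)
Lemma tsat_extends s k (B : fstruct tau) (h : var -> B) (g : tV t -> B) :
  decomposed s k fset0 t -> tsat h g <-> extends tiota g.
Proof.
move=> dec; split=> [[kk /allP kP]|[hU [hh hg]]].
  exists (fun u => ev h g kk (temb u)); split=> // R u.
  rewrite inE => /kP; rewrite /aholds /=.
  suff -> : map_tuple (ev h g kk) (map_tuple temb u) =
    map_tuple (fun u => ev h g kk (temb u)) u by [].
  by apply: eq_from_tnth => i; rewrite !tnth_map.
exists (fun w => hU (Some (inr w))); apply/allP => a ain.
have := hh (tag a) (map_tuple tunemb (tagged a)).
have nolab x : x \in avars a -> temb (tunemb x) = x.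
  case: x => [[n|v]|w] // /(decomposed_labels dec ain).
  by rewrite inE.
have -> : map_tuple tunemb (tagged a) \in interp tstruct (tag a).
  rewrite inE; suff -> : map_tuple temb (map_tuple tunemb (tagged a)) = tagged a.
    by case: a ain {nolab}.
  by apply: eq_from_tnth => i; rewrite !tnth_map nolab ?mem_tnth.
move=> /(_ isT); rewrite /aholds.
suff -> : map_tuple hU (map_tuple tunemb (tagged a)) =
  map_tuple (ev h g (fun w => hU (Some (inr w)))) (tagged a) by [].
apply: eq_from_tnth => i; rewrite !tnth_map.
have : tnth (tagged a) i \in avars a by rewrite mem_tnth.
case: (tnth _ _) => [[n|v]|w] //=; last by rewrite -hg.
by move=> /(decomposed_labels dec ain); rewrite inE.
Qed.

Lemma tcount_ext s k (B : fstruct tau) (h : var -> B) :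
  decomposed s k fset0 t -> tcount h t = #|ext_set tiota B|.
Proof.
move=> dec; rewrite -sum1_card big_mkcond /=; apply: eq_bigr => g _.
rewrite inE; case: asboolP => [/(tsat_extends _ _ dec)/asboolP->//|ng].
by case: asboolP => // /(tsat_extends _ _ dec).
Qed.

End TermStructure.

Section QuantifiedGraph.
Variables (tau : signature) (phi : pp_formula tau).

Definition quant_graph := induced (@pp_graph tau phi) (~: pp_lib phi).

Lemma pp_graph_sym : symmetric (@pp_graph tau phi).
Proof.
by move=> u v; rewrite /pp_graph /= eq_sym; congr andb; apply/asboolP/asboolP;
  move=> [R [t [? ? ?]]]; exists R, t.
Qed.

Lemma quant_graph_sym : connect_sym quant_graph.
Proof.
apply: sym_connect_sym => u v; rewrite /quant_graph !inducedE andbCA pp_graph_sym.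
by [].
Qed.

Lemma connect_quant a b :
  a \notin pp_lib phi -> connect quant_graph a b -> b \notin pp_lib phi.
Proof.
move=> aS /connectP[p pp ->]; elim: p a aS pp => //= y p IH a aS /andP[].
by move=> /and3P[_]; rewrite inE => yS _; apply: IH.
Qed.

End QuantifiedGraph.

Arguments quant_graph {tau} phi.

Section CoreEmbedding.
Variables (tau : signature) (phi : pp_formula tau).

(** Equal counts give homomorphisms [h1] and [h2] in both directions that match the liberal
    variables. A round trip [k] starting with [h1] and fixing S is injective on the image of [c] by
    minimality, hence so is [h1]. *)
Lemma core_embeds (A' : fstruct tau) (S' : finType) (i' : S' -> A') c :
  injective i' -> 0 < #|A'| ->
  (forall B : fstruct tau, 0 < #|B| -> #|answers phi B| = #|ext_set i' B|) ->
  core_endo c ->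
  exists h : pp_struct phi -> A',
    [/\ is_hom h, {in codom c &, injective h}
      & [set h x | x in pp_lib phi] = [set i' s | s : S']].
Proof.
move=> i'_inj A'0 eqc [[chom cfix] cmin].
have eqc' (B : fstruct tau) : 0 < #|B| ->
    #|ext_set (fun s : lib_type phi => val s) B| = #|ext_set i' B| := eqc B.
have [h1 [h1hom h1S]] := count_equiv_hom val_inj i'_inj A'0 eqc'.
have libE : [set val s | s : lib_type phi] = pp_lib phi.
  apply/setP => x; apply/imsetP/idP => [[s _ ->]|xS]; first exact: valP.
  by exists (Sub x xS).
have {}h1S : [set h1 x | x in pp_lib phi] = [set i' s | s : S'].
  transitivity (h1 @: [set val s | s : lib_type phi]); first by rewrite libE.
  by rewrite -h1S -imset_comp.
exists h1; split=> //.
(* Counts agree only over nonempty structures, so an empty universe is dealt with separately. *)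
have [A0 x|A0] := posnP #|pp_struct phi|; first by have := fintype0 x; rewrite A0.
have [|h2 [h2hom h2S]] := @count_equiv_hom tau _ _ i' (pp_struct phi)
  (lib_type phi) (fun s => val s) i'_inj val_inj A0.
  by move=> B B0; rewrite eqc'.
pose g := h2 \o h1.
have gS : [set g x | x in pp_lib phi] = pp_lib phi.
  transitivity (h2 @: [set h1 x | x in pp_lib phi]); first by rewrite -imset_comp.
  by rewrite h1S -imset_comp -[RHS]libE -h2S.
have ginj : {in pp_lib phi &, injective g} by apply/imset_injP; rewrite gS.
have glib (x : lib_type phi) : g (val x) \in pp_lib phi.
  by rewrite -[in X in _ \in X]gS imset_f // (valP x).
pose gl (x : lib_type phi) : lib_type phi := Sub (g (val x)) (glib x).
have gl_inj : injective gl.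
  by move=> x y /(congr1 val) /= /ginj xy; apply: val_inj; apply: xy; apply: valP.
pose p := perm gl_inj.
have giter n x : val (iter n gl x) = iter n g (val x).
  by elim: n => //= n ->.
(* Take [n.+1] to be the order of the permutation that [g] induces on the liberal variables. *)
have [n gn] : exists n, forall x, x \in pp_lib phi -> iter n.+1 g x = x.
  exists #[p]%g.-1 => x xS; rewrite prednK ?order_gt0 //.
  have /permP/(_ (Sub x xS : lib_type phi)) := expg_order p.
  rewrite permX perm1 => /(congr1 val) /=.
  rewrite (eq_iter (f' := gl)) ?giter //; by move=> y; rewrite permE.
pose k := c \o (iter n g \o h2) \o h1.
have kfix x : x \in pp_lib phi -> k x = x.
  by move=> xS; rewrite /k /= -[h2 (h1 x)]/(g x) -iterSr gn // cfix.
have khom : is_hom k.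
  apply: (is_hom_comp _ h1hom); apply: (is_hom_comp chom).
  by apply: (is_hom_comp _ h2hom); apply/is_hom_iter/(is_hom_comp h2hom h1hom).
have := cmin (k \o c); have -> : fixing_endo (k \o c) <-> True.
  split=> // _; split; first exact: is_hom_comp.
  by move=> s sS; rewrite /= cfix // kfix.
move=> /(_ I) le_c.
(* The image of [k \o c] is at least as large as that of [c], so [k] loses no element of the
   latter. *)
have : {in [set x in codom c] &, injective k}.
  apply/imset_injP; rewrite eqn_leq leq_imset_card /=.
  rewrite cardsE; apply: leq_trans le_c _; apply: subset_leq_card.
  apply/subsetP => _ /codomP[x ->]; apply/imsetP; exists (c x) => //.
  by rewrite inE codom_f.
move=> kinj x y xc yc hxy; apply: kinj; rewrite ?inE //.
by rewrite /k /= hxy.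
Qed.

(** The characters live on nonempty structures, which are closed under products. The relation has
    leading factor 1, and [phi] has exactly one answer over the full one-point structure. *)
Lemma representation_embeds psi :
  sharpPP_representation psi phi -> exists t : term tau,
    (forall s k, sharp_bound s k psi -> decomposed s k fset0 t) /\
    forall c, core_endo c -> exists h : pp_struct phi -> tstruct t,
      [/\ is_hom h, {in codom c &, injective h}
        & [set h x | x in pp_lib phi] = [set tiota v | v : tV t]].
Proof.
move=> [pp [wf free0 rep]]; have [I [cc [t [dec ev]]]] := sharp_terms pp wf.
rewrite free0 in dec ev.
have dec0 i : decomposed true (sharp_width psi) fset0 (t i).
  by apply: dec; rewrite -sharp_widthE.
pose X := {B : fstruct tau | 0 < #|B|}.
have mulP (x y : X) : 0 < #|prod_struct (sval x) (sval y)|.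
  by rewrite card_prod muln_gt0 (svalP x) (svalP y).
pose mul (x y : X) : X := exist _ (prod_struct (sval x) (sval y)) (mulP x y).
have oneP : 0 < #|full_struct tau unit| by rewrite card_unit.
pose one : X := exist _ (full_struct tau unit) oneP.
have [|||||i iE] := @multiplicative_independence X mul I
  (fun x => #|ext_set (fun s : lib_type phi => val s) (sval x)|%:Z)%R
  (fun i x => #|ext_set (@tiota _ (t i)) (sval x)|%:Z)%R one 1%R (index_enum I) cc.
- by move=> x y; rewrite card_ext_prod PoszM.
- by move=> i x y; rewrite card_ext_prod PoszM.
- by rewrite card_ext_full ?card_unit ?exp1n //; apply: val_inj.
- by [].
- move=> [B B0]; rewrite GRing.mul1r /= -[X in X%:Z%R]/(#|answers phi B|) rep //.
  have /card_gt0P[b _] := B0; rewrite (ev B _ (fun=> b)) //.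
  by apply: eq_bigr => i _; rewrite (tcount_ext _ (dec0 i)).
exists (t i); split=> [s k|c]; first exact: dec.
apply: core_embeds; first exact: tiota_inj.
  by apply/card_gt0P; exists None.
by move=> B B0; have [] := iE (exist _ B B0).
Qed.

Lemma image_hom (A' : fstruct tau) (h : pp_struct phi -> A') c R
    (u : (arity R).-tuple (image_struct c)) :
  is_hom h -> is_hom c -> u \in interp (image_struct c) R ->
  map_tuple (fun x => h (val x)) u \in interp A' R.
Proof.
move=> hh hc; rewrite inE => /imsetP[u' u'R uE].
suff -> : map_tuple (fun x => h (val x)) u = map_tuple (h \o c) u'.
  exact: (is_hom_comp hh hc).
have -> : map_tuple (h \o c) u' = map_tuple h (map_tuple c u').
  by apply: eq_from_tnth => i; rewrite !tnth_map.
by rewrite -uE; apply: eq_from_tnth => i; rewrite !tnth_map.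
Qed.

Section Widths.
Variables (t : term tau) (s : bool) (c : pp_struct phi -> pp_struct phi).
Variable h : pp_struct phi -> tstruct t.
Hypothesis ccore : core_endo c.
Hypothesis hhom : is_hom h.
Hypothesis hinj : {in codom c &, injective h}.

Definition core_emb (x : pp_struct (image_formula c)) : ((var + tV t) + tW t)%type :=
  temb (h (val x)).

Lemma core_emb_inj : injective core_emb.
Proof.
by move=> x y /temb_inj /hinj xy; apply: val_inj; apply: xy; apply: valP.
Qed.

Lemma core_emb_edge (bs : seq {fset ((var + tV t) + tW t)%type}) x y :
  (forall a, a \in tats t -> exists2 b : {fset _}, b \in bs & {subset avars a <= b}) ->
  pp_graph x y ->
  exists2 b, b \in bs & (core_emb x \in b) && (core_emb y \in b).
Proof.
move=> ats /andP[_ /asboolP[R [u [uR xu yu]]]].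
have := image_hom hhom (proj1 (proj1 ccore)) uR.
rewrite inE => /ats[b bin sub]; exists b => //.
by rewrite !sub //; apply/mapP; eexists; rewrite ?map_f //;
  exact: (map_f (fun x => h (val x))).
Qed.

Lemma core_emb_size (T : finType) (f : T -> pp_struct (image_formula c)) b :
  injective f -> (forall x, counted s (core_emb (f x))) ->
  #|[set x | core_emb (f x) \in b]| <= bsize s b.
Proof.
move=> f_inj cf; apply: leq_trans (card_preim_fset _ (inj_comp core_emb_inj f_inj)).
apply: subset_leq_card; apply/subsetP => x; rewrite !inE /= => ->.
by rewrite cf.
Qed.

End Widths.

Variables (t : term tau) (k : nat) (c : pp_struct phi -> pp_struct phi).
Variable h : pp_struct phi -> tstruct t.
Hypothesis ccore : core_endo c.
Hypothesis hhom : is_hom h.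
Hypothesis hinj : {in codom c &, injective h}.

(** Bags of size [k] mean width [k-1]; the weaker bound [k] spares the case [k = 0]. *)
Lemma core_graph_width :
  decomposed false k fset0 t -> treewidth_le (@pp_graph tau (image_formula c)) k.
Proof.
move=> [bs [ripb _ bk ats _]]; apply: rip_treewidth_embed ripb _ _.
- move=> b /bk bb; apply: leq_trans (leq_trans bb (leqnSn k)).
  exact: (@core_emb_size t false c h hinj _ id).
- by move=> x y; apply: (core_emb_edge ccore hhom).
Qed.

Hypothesis hlib : [set h x | x in pp_lib phi] = [set tiota v | v : tV t].

Let phiC := image_formula c.
Let G := quant_graph phiC.

(** A quantified element of the core goes to a quantified vertex of [t], hence lies in a single bag.
    Edges propagate this bag through the component, and each adjacent liberal variable shares it. So
    all of an ∃-component is in one bag. *)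
Lemma core_contract_width :
  decomposed true k fset0 t -> treewidth_le (@contract tau phiC) k.
Proof.
move=> [bs [ripb bL bk ats buniq]].
set Bs := rcons _ _ in ripb bk ats; pose F := core_emb (c := c) h.
have cfix := proj2 (proj1 ccore).
have edge x y : pp_graph x y -> exists2 b, b \in Bs & (F x \in b) && (F y \in b).
  exact: (core_emb_edge ccore hhom).
(* Every [tiota v] is already the image of a liberal variable, and [h] is injective on the core. *)
have quantF u : u \notin pp_lib phiC -> forall v, h (val u) <> Some (inl v).
  move=> uS v huv; have : tiota v \in [set h x | x in pp_lib phi].
    by rewrite hlib imset_f.
  move=> /imsetP[x xS]; rewrite /tiota -huv => hx.
  move: uS; rewrite inE => /negP[]; rewrite (hinj _ _ hx) //; first exact: valP.
  by rewrite -(cfix _ xS) codom_f.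
have inrF u b : u \notin pp_lib phiC -> b \in Bs -> F u \in b ->
    b \in bs /\ exists w, F u = inr w.
  move=> uS; have := quantF u uS; rewrite /F /core_emb mem_rcons inE.
  case: (h (val u)) => [[v|w]|] /=; first by move=> /(_ v).
    move=> _ /orP[/eqP->|bin] wb; first by move: wb => /labsP[].
    by split=> //; exists w.
  (* The padding element embeds as a name, and with empty label set no bag contains a name. *)
  move=> _ /orP[/eqP->|bin]; first by rewrite mem_labs inE.
  by move=> /(bL _ _ bin); rewrite inE.
have uniqF u b b' : u \notin pp_lib phiC -> b \in Bs -> b' \in Bs ->
    F u \in b -> F u \in b' -> b = b'.
  move=> uS bin b'in ub ub'; have [bin' [w uw]] := inrF _ _ uS bin ub.
  have [b'in' _] := inrF _ _ uS b'in ub'.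
  by apply: (buniq isT _ _ w) => //; rewrite -uw.
have conn u v b : u \notin pp_lib phiC -> connect G u v -> b \in Bs ->
    F u \in b -> F v \in b.
  move=> uS /connectP[p pp ->] bin; elim: p u uS pp => //= y p IH u uS /andP[].
  move=> /and3P[_]; rewrite inE => yS /edge[b' b'in /andP[ub' yb']] pp ub.
  by apply: IH pp _; rewrite // (uniqF _ _ _ uS bin b'in ub ub').
apply: (rip_treewidth_embed (e := fun x : lib_type phiC => F (val x)) ripb).
- move=> b /bk bb; apply: leq_trans (leq_trans bb (leqnSn k)).
  apply: (@core_emb_size t true c h hinj _ val); first exact: val_inj.
  move=> x; have xS : val (val x) \in pp_lib phi.
    by have := valP x; rewrite inE.
  have : h (val (val x)) \in [set tiota v | v : tV t] by rewrite -hlib imset_f.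
  by rewrite /core_emb => /imsetP[v _ ->].
move=> x y /andP[_ /orP[/edge//|/existsP[a /and3P[aS xa ya]]]].
have inEx (z : lib_type phiC) : val z \in ex_component a ->
    exists2 v, connect G a v & pp_graph (val z) v.
  rewrite !inE => /orP[/(connect_quant aS)|].
    by move/negP; case; apply: valP.
  by move=> /andP[_ /exists_inP[v]]; rewrite inE => av zv; exists v.
have [v av xv] := inEx _ xa; have [v' av' yv'] := inEx _ ya.
have [b bin /andP[xb vb]] := edge _ _ xv.
have [b' b'in /andP[yb' v'b']] := edge _ _ yv'.
exists b => //; rewrite xb /=.
have vS := connect_quant aS av; have v'S := connect_quant aS av'.
have v'b : F v' \in b.
  by apply: conn bin vb; rewrite //; apply: connect_trans av'; rewrite quant_graph_sym.
by rewrite (uniqF _ _ _ v'S bin b'in v'b v'b').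
Qed.

End CoreEmbedding.

(** * Elimination of variables along a tree decomposition *)

Lemma fdisjoint_memP (K : choiceType) (A B : {fset K}) :
  reflect (forall x, x \in A -> x \in B -> False) [disjoint A & B]%fset.
Proof.
apply: (iffP (@fdisjointP _ _ _)) => H x xA; first by move=> xB; move: (H x xA); rewrite xB.
by apply/negP; apply: H.
Qed.

Lemma sum_override (B : finType) (h : assignment B) (X Y Z : {fset var})
    (Phi : assignment B -> int) :
  [disjoint X & Y]%fset -> Z = (X `|` Y)%fset ->
  (\sum_(g : {ffun Z -> B}) Phi (override h g) =
   \sum_(g1 : {ffun X -> B}) \sum_(g2 : {ffun Y -> B})
     Phi (override (override h g1) g2))%R.
Proof.
move=> dXY ZE; have XZ : (X `<=` Z)%fset by rewrite ZE fsubsetUl.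
have YZ : (Y `<=` Z)%fset by rewrite ZE fsubsetUr.
pose f (g : {ffun Z -> B}) : {ffun X -> B} * {ffun Y -> B} :=
  ([ffun x => g (fincl XZ x)], [ffun y => g (fincl YZ y)]).
have f_inj : injective f.
  move=> g g' [/ffunP gX /ffunP gY]; apply/ffunP => z.
  have := valP z; rewrite [X in _ \in X]ZE inE => /orP[zX|zY].
    have := gX [` zX]%fset; rewrite !ffunE.
    by have -> : fincl XZ [` zX]%fset = z by apply: val_inj.
  have := gY [` zY]%fset; rewrite !ffunE.
  by have -> : fincl YZ [` zY]%fset = z by apply: val_inj.
have f_bij : bijective f.
  apply: inj_card_bij => //; rewrite card_prod !card_ffun -expnD -!cardfE ZE.
  by rewrite cardfsU (_ : X `&` Y = fset0)%fset ?cardfs0 ?subn0 //; apply/eqP.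
rewrite pair_bigA (reindex f) /=; last exact: onW_bij.
apply: eq_bigr => g _; congr Phi; apply/funext => x; rewrite /override.
case: insubP => [z _ zx|xZ].
  case: insubP => [y _ yx|xY].
    by rewrite ffunE; congr (Some (g _)); apply: val_inj; rewrite /= zx yx.
  case: insubP => [y _ yx|xX].
    by rewrite ffunE; congr (Some (g _)); apply: val_inj; rewrite /= zx yx.
  by have := valP z; rewrite [X in _ \in X]ZE inE zx (negPf xX) (negPf xY).
have xX : x \notin X by apply: contra xZ; apply: fsubsetP.
have xY : x \notin Y by apply: contra xZ; apply: fsubsetP.
by rewrite !insubN.
Qed.

Definition fcover (bs : seq {fset var}) : {fset var} :=
  foldr (fun b X => b `|` X)%fset fset0 bs.

Lemma mem_fcover (bs : seq {fset var}) (x : var) :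
  reflect (exists2 b, b \in bs & x \in b) (x \in fcover bs).
Proof.
elim: bs => [|b bs IH] /=; first by rewrite inE; constructor => -[].
rewrite inE; apply: (iffP orP) => [[xb|/IH[b' b'in xb']]|[b' + xb']].
- by exists b; rewrite ?mem_head.
- by exists b'; rewrite // inE b'in orbT.
- rewrite inE => /orP[/eqP <-|b'in]; first by left.
  by right; apply/IH; exists b'.
Qed.

Lemma pairwise_filterC (T : eqType) (r : rel T) (a : pred T) (s : seq T) :
  symmetric r -> pairwise r s ->
  [/\ pairwise r (filter a s), pairwise r (filter (predC a) s)
    & forall x y, x \in filter a s -> y \in filter (predC a) s -> r x y].
Proof.
move=> rsym; elim: s => // x s IH /= /andP[/allP rx /IH[p1 p2 p12]].
case: (boolP (a x)) => ax /=; split=> //.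
- by rewrite p1 andbT; apply/allP => y; rewrite mem_filter => /andP[_ /rx].
- move=> y z; rewrite inE => /orP[/eqP->|yin] zin; last exact: p12.
  by apply: rx; move: zin; rewrite mem_filter => /andP[].
- by rewrite p2 andbT; apply/allP => y; rewrite mem_filter => /andP[_ /rx].
- move=> y z yin; rewrite inE => /orP[/eqP->|zin]; last exact: p12.
  by rewrite rsym; apply: rx; move: yin; rewrite mem_filter => /andP[].
Qed.

Section Elimination.
Variable tau : signature.
Implicit Types (p q : fo tau) (psi F : sharp tau).

(** Classical equality suffices here: it only serves membership in lists of formulas. *)
HB.instance Definition _ := gen_eqMixin (fo tau).
HB.instance Definition _ := gen_eqMixin (sharp tau).

Lemma eq_sat (B : fstruct tau) p (h h' : assignment B) :
  (forall x, x \in fo_free p -> h x = h' x) -> sat h p = sat h' p.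
Proof.
elim: p h h' => [R args|p IH|p IHp q IHq|p IHp q IHq|x p IH|x p IH] h h' /= hh'.
- have -> // : map h args = map h' args.
  by apply/eq_in_map => x xa; apply: hh'; rewrite inE.
- by rewrite (IH h h').
- by rewrite (IHp h h') 1?(IHq h h') // => x xf; apply: hh'; rewrite inE xf ?orbT.
- by rewrite (IHp h h') 1?(IHq h h') // => x xf; apply: hh'; rewrite inE xf ?orbT.
- apply: eq_existsb => b; apply: IH => y yf; rewrite /update.
  by case: eqP => // /eqP yx; apply: hh'; rewrite !inE yx.
- apply: eq_forallb => b; apply: IH => y yf; rewrite /update.
  by case: eqP => // /eqP yx; apply: hh'; rewrite !inE yx.
Qed.

Definition total (B : Type) (h : var -> B) : assignment B := fun x => Some (h x).

Lemma fo_boundW k k' p : k <= k' -> fo_bound k p -> fo_bound k' p.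
Proof. by move=> kk'; apply: sub_all => q; move/leq_trans; apply. Qed.

(** The list must be nonempty because pp-syntax has no formula for truth. *)
Lemma pp_conj (ps : seq (fo tau)) (X : {fset var}) k :
  ps != [::] -> #|` X| <= k ->
  (forall p, p \in ps -> [/\ is_pp p, fo_bound k p & fo_free p `<=` X]%fset) ->
  exists q, [/\ is_pp q, fo_bound k q, (fo_free q `<=` X)%fset
    & forall (B : fstruct tau) (h : assignment B), sat h q = all (sat h) ps].
Proof.
elim: ps => // p [|p' ps] IH _ Xk psP.
  have [|pp pk pX] := psP p; first by rewrite mem_head.
  by exists p; split=> // B h; rewrite /= andbT.
have [|||q [qpp qk qX qs]] := IH => //.
  by move=> r rin; apply: psP; rewrite inE rin orbT.
have [|pp pk pX] := psP p; first by rewrite mem_head.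
have pqX : (fo_free p `|` fo_free q `<=` X)%fset by rewrite fsubUset pX.
exists (FAnd p q); split=> //=.
- by rewrite pp.
- rewrite /fo_bound /= all_cat; apply/and3P; split=> //.
  exact: leq_trans (fsubset_leq_card pqX) Xk.
- by move=> B h; rewrite qs.
Qed.

Lemma pp_ex (xs : seq var) p k :
  is_pp p -> fo_bound k p -> exists q, [/\ is_pp q, fo_bound k q,
      forall x, x \in fo_free q -> (x \in fo_free p) && (x \notin xs)
    & forall (B : fstruct tau) (h0 : var -> B), sat (total h0) q <->
        exists h1 : var -> B, (forall x, x \notin xs -> h1 x = h0 x) /\ sat (total h1) p].
Proof.
move=> pp pk; elim: xs => [|x xs [q [qpp qk qf qs]]].
  exists p; split=> // [x ->//|B h0]; split=> [|[h1 [hh]]]; first by exists h0.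
  by rewrite (_ : h1 = h0) //; apply/funext => x; apply: hh.
have updE (B : fstruct tau) (h : var -> B) b :
    update (total h) x b = total (fun y => if y == x then b else h y).
  by apply/funext => y; rewrite /update /total; case: eqP.
exists (FEx x q); split=> //=.
- rewrite /fo_bound /=; apply/andP; split=> //.
  by apply: leq_trans (fo_bound_sub qk); rewrite fsubset_leq_card ?fsubD1set.
- by move=> y; rewrite !inE => /andP[yx /qf/andP[-> yxs]]; rewrite negb_or yx.
- move=> B h0; split=> [/existsP[b]|[h1 [hh hp]]].
    rewrite updE => /qs[h1 [hh hp]]; exists h1; split=> // y.
    by rewrite inE negb_or => /andP[/negPf yx /hh ->]; rewrite yx.
  apply/existsP; exists (h1 x); rewrite updE; apply/qs; exists h1; split=> // y yxs.
  by case: eqP => [->//|/eqP yx]; apply: hh; rewrite inE negb_or yx.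
Qed.

(** The formulas living in the first bag are conjoined and the variables private to that bag are
    quantified. The result fits into the witness bag together with [L] and joins the remaining
    formulas. The set [L] stays free throughout, hence its share in every size bound. *)
Lemma pp_elim m (L : {fset var}) (bs : seq {fset var}) (ps : seq (fo tau)) :
  rip bs -> (forall b, b \in fset0 :: bs -> #|` (b `|` L)%fset| <= m) ->
  ps != [::] ->
  (forall p, p \in ps -> [/\ is_pp p, fo_bound m p
    & exists2 b, b \in fset0 :: bs & (fo_free p `<=` b `|` L)%fset]) ->
  exists q, [/\ is_pp q, fo_bound m q, (fo_free q `<=` L)%fset
    & forall (B : fstruct tau) (h0 : var -> B), sat (total h0) q <->
        exists h1 : var -> B, (forall x, x \in L -> h1 x = h0 x) /\
          forall p, p \in ps -> sat (total h1) p].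
Proof.
elim: bs ps => [|b bs IH] ps.
  move=> _ szb ps0 psP.
  have [|p pin|q [qpp qk qX qs]] := @pp_conj ps (fset0 `|` L)%fset m ps0.
  - by apply: szb; rewrite mem_head.
  - by have [-> -> [b]] := psP p pin; rewrite inE => /eqP->.
  rewrite fset0U in qX.
  exists q; split=> // B h0; split=> [hq|[h1 [hh /allP]]].
    by exists h0; split=> // p pin; move: hq; rewrite qs => /allP; apply.
  rewrite -qs (@eq_sat _ _ _ (total h0)) // => x /(fsubsetP qX) xL.
  by rewrite /total hh.
move=> /= [ripb [p0 p0in bp0]] szb ps0 psP.
have szb' b' : b' \in fset0 :: bs -> #|` (b' `|` L)%fset| <= m.
  by rewrite inE => /orP[] b'in; apply: szb; rewrite !inE b'in ?orbT.
pose inb (p : fo tau) := (fo_free p `<=` b `|` L)%fset.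
(* A bag without formulas is skipped, as an empty conjunction cannot be written. *)
have [nob|someb] := eqVneq (filter inb ps) [::].
  apply: IH => // p pin; have [pp pk [b' b'in pb']] := psP p pin; split=> //.
  exists b' => //; move: b'in; rewrite !inE => /or3P[->//|/eqP b'b|->]; last by rewrite orbT.
  have : p \in filter inb ps by rewrite mem_filter pin /inb -b'b pb'.
  by rewrite nob.
have [||q [qpp qk qb qs]] := @pp_conj _ (b `|` L)%fset m someb.
- by apply: szb; rewrite !inE eqxx orbT.
- by move=> p; rewrite mem_filter => /andP[pb /psP[]].
pose E := [fset x in b | ~~ has (fun b' : {fset var} => x \in b') bs && (x \notin L)]%fset.
have [q' [q'pp q'k q'f q's]] := pp_ex (enum_fset E) qpp qk.
have inE' x : (x \in enum_fset E) = (x \in E) by [].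
have q'p0 : (fo_free q' `<=` p0 `|` L)%fset.
  apply/fsubsetP => x /q'f /andP[/(fsubsetP qb)]; rewrite inE' !inE /=.
  case: (x \in L); rewrite ?orbT // orbF orbF andbT => xb.
  by rewrite xb /= negbK => /hasP[b' b'in xb']; apply: bp0 b'in xb xb'.
have [|r [rpp rk rL rs]] := IH (q' :: filter (predC inb) ps) ripb szb' isT.
- move=> p; rewrite inE => /orP[/eqP->|].
    by split=> //; exists p0.
  rewrite mem_filter => /andP[npb /psP[pp pk [b' b'in pb']]]; split=> //.
  exists b' => //; move: b'in; rewrite !inE => /or3P[->//|/eqP b'b|->]; last by rewrite orbT.
  by move: npb; rewrite /= /inb -b'b pb'.
exists r; split=> // B h0; rewrite rs; split=> -[h1 [hL hps]].
  have [|h2 [h21 h2q]] := (q's B h1).1; first by apply: hps; rewrite mem_head.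
  exists h2; split=> [x xL|p pin].
    by rewrite -hL // h21 // inE' !inE /= xL !andbF.
  case: (boolP (inb p)) => [pb|npb].
    by move: h2q; rewrite qs => /allP; apply; rewrite mem_filter pb.
  (* Changing [h1] to [h2] affects only variables private to [b], and [p] lives in a later bag. *)
  have : sat (total h1) p by apply: hps; rewrite inE mem_filter /= npb pin orbT.
  rewrite (@eq_sat _ _ _ (total h2)) // => x xp; rewrite /total h21 // inE' !inE /=.
  have [_ _ [b' b'in pb']] := psP p pin.
  have := fsubsetP pb' x xp; rewrite inE => /orP[xb'|->]; last by rewrite !andbF.
  suff -> : has (fun b' : {fset var} => x \in b') bs by rewrite andbF.
  apply/hasP; exists b' => //; move: b'in; rewrite !inE => /or3P[/eqP b'0|/eqP b'b|//].
    by rewrite b'0 inE in xb'.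
  by move: npb; rewrite /inb -b'b pb'.
exists h1; split=> // p; rewrite inE => /orP[/eqP->|].
  apply/q's; exists h1; split=> //; rewrite qs; apply/allP => p'.
  by rewrite mem_filter => /andP[_]; apply: hps.
by rewrite mem_filter => /andP[_]; apply: hps.
Qed.

Lemma eq_sharp_eval (B : fstruct tau) psi (h h' : assignment B) :
  sharp_wf psi -> (forall x, x \in sharp_free psi -> h x = h' x) ->
  sharp_eval psi h = sharp_eval psi h'.
Proof.
elim: psi h h' => [p L|X psi IH|X psi IH|F1 IH1 F2 IH2|F1 IH1 F2 IH2|n] h h' //=.
- by move=> /fsubsetP pL hh; rewrite (@eq_sat _ _ h h') // => x /pL/hh.
- move=> /andP[wf _] hh; apply: eq_bigr => g _; apply: IH => // x xf.
  by rewrite /override; case: insubP => // xX; apply: hh; rewrite inE xX.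
- move=> /and3P[wf _ _] hh; apply: IH => // x xf; rewrite /restrict xf.
  by apply: hh; rewrite inE xf orbT.
- move=> /and4P[wf1 wf2 /eqP ff _] hh.
  by rewrite (IH1 h h') // (IH2 h h') // => x; rewrite -ff; apply: hh.
- move=> /and3P[wf1 wf2 /eqP ff] hh.
  by rewrite (IH1 h h') // (IH2 h h') // => x; rewrite -ff; apply: hh.
Qed.

Definition closed_disjoint : rel (sharp tau) :=
  fun F F' => [disjoint sharp_closed F & sharp_closed F']%fset.

(** Factors of a product must have equal free sets, so each is padded to [b] by [SE]. The padded
    constant 1 allows the empty product. *)
Lemma sharp_prod s k (b : {fset var}) (Fs : seq (sharp tau)) :
  #|` b| <= k -> pairwise closed_disjoint Fs ->
  (forall F, F \in Fs -> [/\ is_sharpPP F, sharp_wf F, sharp_bound s k F,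
     (sharp_free F `<=` b)%fset & [disjoint b & sharp_closed F]%fset]) ->
  exists G, [/\ [/\ is_sharpPP G, sharp_wf G & sharp_bound s k G], sharp_free G = b,
     forall x, x \in sharp_closed G -> exists2 F, F \in Fs & x \in sharp_closed F
   & forall (B : fstruct tau) (h : assignment B),
       sharp_eval G h = (\prod_(F <- Fs) sharp_eval F h)%R].
Proof.
move=> bk; elim: Fs => [_ _|F Fs IH /= /andP[dF dFs] FsP].
  exists (SE b (SInt tau 1)); split=> //=.
  - split=> //; first by rewrite !fdisjointX0.
    by rewrite /sharp_bound /= fsetU0 bk ?cardfs0 /= ?orbT.
  - by rewrite fsetU0.
  - by move=> B h; rewrite big_nil.
have [||G [[Gpp Gwf Gb] Gf Gc Ge]] := IH => //.
  by move=> F' F'in; apply: FsP; rewrite inE F'in orbT.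
have [|Fpp Fwf Fb Ff Fc] := FsP F; first by rewrite mem_head.
have fE : (b `\` sharp_free F `|` sharp_free F)%fset = b.
  apply/fsetP => x; rewrite !inE; case: (boolP (x \in sharp_free F)) => //= xF.
    by rewrite (fsubsetP Ff).
  by rewrite orbF.
exists (SMul (SE (b `\` sharp_free F)%fset F) G); split=> //=.
- split; first by rewrite Fpp.
    rewrite Fwf Gwf fE Gf eqxx /= -andbA; apply/and3P; split.
    + by apply/fdisjoint_memP => x; rewrite inE => /andP[/negP].
    + by apply/fdisjoint_memP => x; rewrite inE => /andP[_]; apply/fdisjoint_memP.
    + apply/fdisjoint_memP => x xF /Gc[F' F'in].
      by move: (allP dF _ F'in); rewrite /closed_disjoint => /fdisjoint_memP/(_ x xF).
  move: Fb Gb; rewrite /sharp_bound /= !all_cat fE bk /=.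
  move=> /andP[-> Fb] /andP[-> Gb] /=; case: s {IH FsP} Fb Gb => //= -> ->.
  by [].
- move=> x; rewrite inE => /orP[xF|/Gc[F' F'in xF']].
    by exists F; rewrite ?mem_head.
  by exists F'; rewrite // inE F'in orbT.
- move=> B h; rewrite big_cons Ge; congr (_ * _)%R; apply: eq_sharp_eval => // x xF.
  by rewrite /restrict xF.
Qed.

(** Same elimination with products and sums: factors living in the first bag are multiplied, and its
    private variables are summed out by distributivity. A variable is closed only once it has left
    all later bags, which keeps closed sets disjoint. *)
Lemma sharp_elim s k (bs : seq {fset var}) (Fs : seq (sharp tau)) :
  rip bs -> (forall b, b \in bs -> #|` b| <= k) -> pairwise closed_disjoint Fs ->
  (forall F, F \in Fs -> [/\ is_sharpPP F, sharp_wf F, sharp_bound s k F,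
     exists2 b, b \in fset0 :: bs & (sharp_free F `<=` b)%fset
   & forall b, b \in bs -> [disjoint b & sharp_closed F]%fset]) ->
  exists G, [/\ is_sharpPP G, sharp_wf G, sharp_bound s k G, sharp_free G = fset0
   & forall B : fstruct tau, sharp_eval G (@empty_assignment B) =
       (\sum_(g : {ffun fcover bs -> B})
          \prod_(F <- Fs) sharp_eval F (override (@empty_assignment B) g))%R].
Proof.
elim: bs Fs => [|b bs IH] Fs.
  move=> _ _ dis FsP; have [|||G [[Gpp Gwf Gb] Gf _ Ge]] := @sharp_prod s k fset0 Fs.
  - by rewrite cardfs0.
  - by [].
  - move=> F /FsP[Fpp Fwf Fb [b]]; rewrite inE => /eqP-> F0 _; split=> //.
    by rewrite fdisjoint0X.
  exists G; split=> // B; rewrite Ge.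
  rewrite [RHS](eq_bigr (fun=> \prod_(F <- Fs) sharp_eval F (@empty_assignment B))%R).
    by rewrite big_const card_ffun -cardfE cardfs0 expn0 /= GRing.addr0.
  move=> g _; have -> // : override (@empty_assignment B) g = @empty_assignment B.
  by apply/funext => x; rewrite /override insubN.
move=> /= [ripb [p0 p0in bp0]] szb dis FsP.
pose inb F := (sharp_free F `<=` b)%fset.
have [|dis1 dis2 dis12] := pairwise_filterC inb _ dis.
  by move=> F F'; rewrite /closed_disjoint fdisjoint_sym.
have [|||G0 [[G0pp G0wf G0b] G0f G0c G0e]] := @sharp_prod s k b (filter inb Fs).
- by apply: szb; rewrite mem_head.
- by [].
- move=> F; rewrite mem_filter => /andP[Fb /FsP[Fpp Fwf Fk _ Fc]]; split=> //.
  by apply: Fc; rewrite mem_head.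
pose E := (b `\` fcover bs)%fset; pose G := SP E G0.
have Gf : sharp_free G = (b `\` E)%fset by rewrite /= G0f.
have bG0c x : x \in b -> x \in sharp_closed G0 -> False.
  move=> xb /G0c[F]; rewrite mem_filter => /andP[_ /FsP[_ _ _ _ /(_ b)]].
  by rewrite mem_head => /(_ isT)/fdisjoint_memP/(_ x xb).
have [|||H [Hpp Hwf Hb Hf He]] := IH (G :: filter (predC inb) Fs) ripb.
- by move=> b' b'in; apply: szb; rewrite inE b'in orbT.
- rewrite /= dis2 andbT; apply/allP => F Fin; apply/fdisjoint_memP => x.
  have [_ _ _ _ Fc] := FsP F (mem_subseq (filter_subseq _ _) Fin).
  rewrite /= !inE => /orP[/andP[_ xb]|/G0c[F' F'in xF'] xF].
    by move: (Fc b (mem_head _ _)) => /fdisjoint_memP/(_ x xb).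
  by move: (dis12 _ _ F'in Fin) => /fdisjoint_memP/(_ x xF' xF).
- move=> F; rewrite inE => /orP[/eqP->|].
    split=> //.
    + rewrite /= G0wf; apply/fdisjoint_memP => x; rewrite inE => /andP[_].
      exact: bG0c.
    + move: G0b; rewrite /sharp_bound /= => /andP[-> ->]; rewrite !andbT G0f.
      apply: leq_trans (szb b (mem_head _ _)).
      by apply: fsubset_leq_card; apply: fsubsetDl.
    + exists p0 => //; rewrite Gf; apply/fsubsetP => x; rewrite !inE.
      case: (boolP (x \in b)) => xb; rewrite ?andbF // !andbT negbK.
      by move=> /mem_fcover[b' b'in]; apply: bp0.
    + move=> b' b'in; apply/fdisjoint_memP => x xb'; rewrite /= !inE.
      move=> /orP[/andP[/negP xE _]|/G0c[F']]; first by apply: xE; apply/mem_fcover; exists b'.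
      rewrite mem_filter => /andP[_ /FsP[_ _ _ _ /(_ b')]].
      by rewrite inE b'in orbT => /(_ isT)/fdisjoint_memP/(_ x xb').
  rewrite mem_filter => /andP[nFb /FsP[Fpp Fwf Fk [b' b'in Fb'] Fc]]; split=> //.
    exists b' => //; move: b'in; rewrite !inE => /or3P[->//|/eqP b'b|->]; last by rewrite orbT.
    by move: nFb; rewrite /= /inb -b'b Fb'.
  by move=> b1 b1in; apply: Fc; rewrite inE b1in orbT.
exists H; split=> // B; rewrite He.
rewrite (@sum_override _ _ (fcover bs) E _
  (fun h => \prod_(F <- Fs) sharp_eval F h)%R); last first.
- by apply/fsetP => x; rewrite /= !inE; case: (x \in fcover bs); rewrite ?orbT ?orbF.
- by apply/fdisjoint_memP => x xc; rewrite inE xc.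
apply: eq_bigr => g _; rewrite big_cons /= GRing.mulr_suml; apply: eq_bigr => g' _.
rewrite G0e [RHS](perm_big (filter inb Fs ++ filter (predC inb) Fs)) /=; last first.
  by rewrite perm_sym; apply/permPl/perm_filterC.
rewrite big_cat /=; congr (_ * _)%R; apply: eq_big_seq => F Fin.
(* A factor not contained in [b] lives in a later bag, so the values on [E] do not matter to it. *)
have [_ Fwf _ [b' b'in Fb'] _] := FsP F (mem_subseq (filter_subseq _ _) Fin).
apply: eq_sharp_eval => // x /(fsubsetP Fb') xb'.
rewrite /override [in RHS]insubN // !inE negb_and negbK; apply/orP; left.
apply/mem_fcover; exists b' => //; move: b'in; rewrite !inE => /or3P[/eqP b0|/eqP bb|//].
  by rewrite b0 inE in xb'.
by move: Fin; rewrite mem_filter /= /inb -bb Fb'.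
Qed.

End Elimination.

(** * Representations from tree decompositions *)

Section CoreFormula.
Variable tau : signature.
Implicit Types phi : pp_formula tau.

Lemma core_endo_exists phi : exists c : pp_struct phi -> pp_struct phi, core_endo c.
Proof.
pose P n := `[< exists c : pp_struct phi -> pp_struct phi,
                  fixing_endo c /\ #|codom c| = n >].
have exP : exists n, P n.
  exists #|codom (@id (pp_struct phi))|; apply/asboolP; exists id; split=> //.
  split=> // R t tR; suff -> : map_tuple id t = t by [].
  by apply: eq_from_tnth => i; rewrite tnth_map.
case: (ex_minnP exP) => n /asboolP[c [cfix cn]] nmin.
by exists c; split=> // d dfix; rewrite cn; apply: nmin; apply/asboolP; exists d.
Qed.

(** Homomorphisms restrict to the image of [c] and are pulled back along [c]; neither changes the
    values on S. *)
Lemma card_answers_image phi (c : pp_struct phi -> pp_struct phi) (B : fstruct tau) :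
  fixing_endo c -> #|answers phi B| = #|answers (image_formula c) B|.
Proof.
move=> [chom cfix].
have dnP (x : lib_type (image_formula c)) : val (val x) \in pp_lib phi.
  by have := valP x; rewrite inE.
pose dn (x : lib_type (image_formula c)) : lib_type phi := Sub (val (val x)) (dnP x).
have upP (x : lib_type phi) : val x \in codom c.
  by rewrite -(cfix _ (valP x)) codom_f.
have upP' (x : lib_type phi) :
    (Sub (val x) (upP x) : pp_struct (image_formula c)) \in pp_lib (image_formula c).
  by rewrite inE; exact: (valP x).
pose up (x : lib_type phi) : lib_type (image_formula c) := Sub (Sub (val x) (upP x)) (upP' x).
have upK : cancel up dn by move=> x; apply: val_inj.
have dnK : cancel dn up by move=> x; do 2!apply: val_inj.
pose f (g : {ffun lib_type phi -> B}) : {ffun lib_type (image_formula c) -> B} :=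
  [ffun x => g (dn x)].
have f_inj : injective f.
  move=> g g' /ffunP gg; apply/ffunP => x; have := gg (up x).
  by rewrite !ffunE upK.
rewrite -(card_imset _ f_inj); apply: eq_card => g; apply/imsetP/idP => [[g0]|].
  rewrite inE => /asboolP[h [hh hg]] ->; rewrite inE; apply/asboolP.
  exists (fun x => h (val x)); split; last by move=> x; rewrite ffunE -hg.
  by move=> R u uR; apply: (image_hom hh chom uR).
rewrite inE => /asboolP[h [hh hg]]; exists [ffun x => g (up x)]; last first.
  by apply/ffunP => x; rewrite !ffunE dnK.
rewrite inE; apply/asboolP.
pose cc (x : pp_struct phi) : pp_struct (image_formula c) := Sub (c x) (codom_f c x).
exists (fun x => h (cc x)); split=> [R u uR|x].
  have : map_tuple cc u \in interp (image_struct c) R.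
    rewrite inE; apply/imsetP; exists u => //.
    by apply: eq_from_tnth => i; rewrite !tnth_map.
  move=> /hh; suff -> : map_tuple h (map_tuple cc u) = map_tuple (fun x => h (cc x)) u by [].
  by apply: eq_from_tnth => i; rewrite !tnth_map.
rewrite ffunE -hg; congr h; apply: val_inj; rewrite /= cfix //; exact: (valP x).
Qed.

Lemma pp_atoms phi : exists ats : seq (atom tau (pp_struct phi)),
  forall a, (a \in ats) = (tagged a \in interp (pp_struct phi) (tag a)).
Proof.
have [s sP] := pp_fin phi.
exists [seq mkatom t | R <- s, t <- enum (interp (pp_struct phi) R)] => -[R t] /=.
apply/idP/idP => [/allpairsPdep[R' [t' [_ + E]]]|tR].
  rewrite mem_enum => t'R.
  have : tagged (mkatom t') \in interp (pp_struct phi) (tag (mkatom t')) by [].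
  by rewrite -E.
apply/allpairsPdep; exists R, t; split; rewrite ?mem_enum //.
by apply: sP; apply/set0Pn; exists t.
Qed.

Lemma is_hom_atoms phi (B : fstruct tau) (h : pp_struct phi -> B) ats :
  (forall a, (a \in ats) = (tagged a \in interp (pp_struct phi) (tag a))) ->
  is_hom h <-> all (aholds h) ats.
Proof.
move=> atsE; split=> [hh|/allP hats R t tR].
  by apply/allP => a; rewrite atsE; apply: hh.
by apply: (hats (mkatom t)); rewrite atsE.
Qed.

End CoreFormula.

Lemma prod_bool (I : eqType) (s : seq I) (E : I -> int) (P : pred I) :
  (forall i, i \in s -> E i = ((P i : nat)%:Z)%R) ->
  (\prod_(i <- s) E i)%R = ((all P s : nat)%:Z)%R.
Proof.
elim: s => [_|i s IH EP]; first by rewrite big_nil.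
rewrite big_cons EP ?mem_head // IH => [|j js]; last by apply: EP; rewrite inE js orbT.
by rewrite /=; case: (P i); case: (all P s).
Qed.

(** * Factorization over ∃-components and assembly of the ♯-sentence *)

Section Build.
Variables (tau : signature) (phi : pp_formula tau).
Let A := pp_struct phi.
Let S := pp_lib phi.
Variable ats : seq (atom tau A).
Hypothesis atsE : forall a, (a \in ats) = (tagged a \in interp A (tag a)).

Definition name (x : A) : var := enum_rank x.

Lemma name_inj : injective name.
Proof. by move=> x y /val_inj/enum_rank_inj. Qed.

Definition fatom (a : atom tau A) : fo tau := FAtom (map_tuple name (tagged a)).

Lemma fatom_free a n : (n \in fo_free (fatom a)) = (n \in map name (avars a)).
Proof. by rewrite inE. Qed.

Lemma sat_fatom (B : fstruct tau) (h : var -> B) a :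
  sat (total h) (fatom a) = aholds (h \o name) a.
Proof.
have E : map_tuple (h \o name) (tagged a) = map_tuple h (map_tuple name (tagged a)).
  by apply: eq_from_tnth => i; rewrite !tnth_map.
rewrite /aholds E /=; apply/existsP/idP => [[t /andP[tR /eqP tE]]|hR].
  suff <- : t = map_tuple h (map_tuple name (tagged a)) by [].
  apply: val_inj; apply: (inj_map (f := Some)); first by move=> ? ? [].
  by rewrite -tE -!map_comp.
by exists (map_tuple h (map_tuple name (tagged a))); rewrite hR /= -!map_comp.
Qed.

Lemma atom_edge a x y : a \in ats -> x \in avars a -> y \in avars a -> x != y ->
  pp_graph x y.
Proof.
rewrite atsE => aR xa ya xy; rewrite /pp_graph /= xy; apply/asboolP.
by exists (tag a), (tagged a).
Qed.

Definition touching (r : A) : seq (atom tau A) :=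
  [seq a <- ats | has (mem (quant_component r)) (avars a)].

Definition border (r : A) : {fset var} :=
  [fset name x | x in [set x in S | x \in ex_component r]]%fset.

(** Every such element of a component counts, not one representative. Repeated factors do no harm,
    being 0 or 1. *)
Definition proper_root (r : A) : bool := (r \notin S) && (touching r != [::]).

Lemma borderE r x : (name x \in border r) = (x \in S) && (x \in ex_component r).
Proof. by rewrite (mem_imfset _ _ name_inj) /= inE. Qed.

Lemma touching_border r a x : r \notin S -> a \in touching r -> x \in avars a ->
  x \in S -> name x \in border r.
Proof.
move=> rS; rewrite mem_filter => /andP[/hasP[v va vr] ain] xa xS.
rewrite borderE xS /= inE; apply/orP; right; rewrite inE xS /=.
apply/exists_inP; exists v => //; apply: (atom_edge ain) => //.
apply: contraTneq xS => ->; move: vr; rewrite /= inE.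
exact: connect_quant.
Qed.

Lemma touching_quant r a x : r \notin S -> a \in touching r -> x \in avars a ->
  x \notin S -> connect (quant_graph phi) r x.
Proof.
move=> rS; rewrite mem_filter => /andP[/hasP[v va]]; rewrite /= inE => rv ain xa xS.
have [<-//|vx] := eqVneq v x; apply: (connect_trans rv); apply: connect1.
rewrite /quant_graph inducedE !inE xS (connect_quant rS rv) /=.
exact: atom_edge ain va xa vx.
Qed.

Definition pure (a : atom tau A) : bool := all (mem S) (avars a).

(** Every atom is pure or touches one component, so separate witnesses for the components combine
    into one homomorphism. *)
Lemma factors_extend (theta : {r | proper_root r} -> fo tau)
    (B : fstruct tau) (h0 : var -> B) :
  (forall r, sat (total h0) (theta r) <->
     exists h1 : var -> B, (forall x, x \in border (val r) -> h1 x = h0 x) /\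
       forall p, p \in map fatom (touching (val r)) -> sat (total h1) p) ->
  (all (fun a => sat (total h0) (fatom a)) (filter pure ats) /\
   forall r, sat (total h0) (theta r)) <->
  exists h : A -> B, is_hom h /\ forall x, x \in S -> h x = h0 (name x).
Proof.
move=> thetaP; split=> [[/allP pureP thetaH]|[h [/(is_hom_atoms _ atsE)/allP hh hS]]].
  have /choice[kappa kappaP] : forall r : {r | proper_root r}, exists h1 : var -> B,
      (forall x, x \in border (val r) -> h1 x = h0 x) /\
      forall p, p \in map fatom (touching (val r)) -> sat (total h1) p.
    by move=> r; apply/thetaP.
  (* Canonical roots make all variables of a component use the same witness. Without atoms in the
     component, [insub] fails and any value will do. *)
  pose rt := fingraph.root (quant_graph phi).
  exists (fun x => if x \in S then h0 (name x) else
    if insub (rt x) is Some r then kappa r (name x) else h0 (name x)).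
  split; last by move=> x ->.
  apply/(is_hom_atoms _ atsE)/allP => a ain.
  case: (boolP (pure a)) => [pa|/allPn[x xa xS]].
    have : sat (total h0) (fatom a) by apply: pureP; rewrite mem_filter pa.
    rewrite sat_fatom; apply: etrans; apply: eq_in_aholds => x xa /=.
    by move/allP: pa => /(_ _ xa) /= ->.
  have rx : connect (quant_graph phi) (rt x) x.
    by rewrite quant_graph_sym connect_root.
  have rS : rt x \notin S by apply: (connect_quant xS); rewrite quant_graph_sym.
  have at_a : a \in touching (rt x).
    by rewrite mem_filter ain andbT; apply/hasP; exists x; rewrite //= inE.
  have pr : proper_root (rt x).
    by rewrite /proper_root rS; apply: contraTneq at_a => ->.
  pose r : {r | proper_root r} := Sub (rt x) pr.
  have [kb ka] := kappaP r.
  have := ka (fatom a) (map_f fatom at_a).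
  rewrite sat_fatom; apply: etrans; apply: eq_in_aholds => y ya /=.
  case: (boolP (y \in S)) => yS.
    by rewrite kb //; apply: touching_border at_a ya yS.
  have /eqP : rt y == rt x.
    rewrite root_connect; last exact: quant_graph_sym.
    apply: connect_trans rx; rewrite quant_graph_sym.
    exact: touching_quant at_a ya yS.
  by rewrite -[rt y]/(rt y) => ->; rewrite (insubT _ pr).
split=> [|r].
  apply/allP => a; rewrite mem_filter => /andP[/allP pa ain].
  rewrite sat_fatom; have := hh a ain; apply: etrans; apply: eq_in_aholds => x xa /=.
  by rewrite hS //; apply: pa.
apply/thetaP; exists (fun n => if [pick y | name y == n] is Some y then h y else h0 n).
have hE y : (if [pick y' | name y' == name y] is Some y' then h y' else h0 (name y)) = h y.
  by case: pickP => [y' /eqP/name_inj->//|/(_ y)]; rewrite eqxx.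
split=> [n /imfsetP[x /= + ->]|_ /mapP[a + ->]].
  by rewrite inE hE => /andP[xS _]; apply: hS.
rewrite mem_filter => /andP[_ ain]; rewrite sat_fatom.
by have := hh a ain; apply: etrans; apply: eq_in_aholds => y _ /=; rewrite hE.
Qed.

(** Each ∃-component becomes a formula on its border, eliminated along [bsA]. The size [mA] enters
    the bound only for [s = false], where fo-subformulas count. *)
Lemma build_formula (s : bool) (w k mA : nat) (bsA : seq {fset A}) :
  treewidth_le (@contract tau phi) w -> w.+1 <= k ->
  rip bsA -> (forall b, b \in bsA -> #|` b| <= mA) ->
  (forall a, a \in ats -> exists2 b : {fset A}, b \in fset0 :: bsA & {subset avars a <= b}) ->
  s || (mA + w.+1 <= k) ->
  exists G, [/\ is_sharpPP G, sharp_wf G, sharp_bound s k G, sharp_free G = fset0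
    & forall B : fstruct tau, 0 < #|B| ->
        (#|answers phi B|%:Z)%R = sharp_eval G (@empty_assignment B)].
Proof.
move=> /treewidth_rip[bsC [ripC szC covC edgeC]] wk ripA szA atsA sk.
pose nameL (x : lib_type phi) : var := name (val x).
have nameL_inj : injective nameL by move=> x y /name_inj/val_inj.
pose im (b : {fset lib_type phi}) := [fset nameL x | x in b]%fset.
pose bsv := map im bsC.
have ripv : rip bsv by apply: rip_imfset.
have szv b : b \in fset0 :: bsv -> #|` b| <= w.+1.
  rewrite inE => /orP[/eqP->|/mapP[b' b'in ->]]; first by rewrite cardfs0.
  exact: leq_trans (card_imfset_le _ _) (szC _ b'in).
have clique (K : lib_type phi -> Prop) :
    (forall x y, K x -> K y -> x != y -> contract x y) ->
    exists2 b : {fset var}, b \in fset0 :: bsv & forall x, K x -> nameL x \in b.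
  move=> Kc; have [|p pin Kp] := @rip_clique _ _ K ripC.
    move=> x y Kx Ky; have [<-|xy] := eqVneq x y; last exact: edgeC (Kc _ _ Kx Ky xy).
    by have [b bin xb] := covC x; exists b; rewrite ?xb.
  move: pin; rewrite inE => /orP[/eqP p0|pin].
    by exists fset0; rewrite ?mem_head // => x /Kp; rewrite p0 inE.
  exists (im p); first by rewrite inE map_f ?orbT.
  by move=> x /Kp; rewrite (mem_imfset _ _ nameL_inj).
have borderB r : r \notin S ->
    exists2 b : {fset var}, b \in fset0 :: bsv & (border r `<=` b)%fset.
  move=> rS; have [|b bin bP] := clique (fun x => val x \in ex_component r).
    move=> x y xr yr xy; rewrite /contract /= xy /=; apply/orP; right.
    by apply/existsP; exists r; rewrite rS xr.
  exists b => //; apply/fsubsetP => n /imfsetP[x /=]; rewrite inE => /andP[xS xr] ->.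
  exact: (bP (Sub x xS)).
have pureB a : a \in ats -> pure a ->
    exists2 b : {fset var}, b \in fset0 :: bsv & (fo_free (fatom a) `<=` b)%fset.
  move=> ain /allP pa; have [|b bin bP] := clique (fun x => val x \in avars a).
    move=> x y xa ya xy; rewrite /contract /= xy /=.
    by rewrite (atom_edge ain xa ya).
  exists b => //; apply/fsubsetP => n; rewrite fatom_free => /mapP[x xa ->].
  exact: (bP (Sub x (pa _ xa))).
pose imA (b : {fset A}) := [fset name x | x in b]%fset.
have szimA b : b \in fset0 :: map imA bsA -> #|` b| <= mA.
  rewrite inE => /orP[/eqP->|/mapP[b' b'in ->]]; first by rewrite cardfs0.
  exact: leq_trans (card_imfset_le _ _) (szA _ b'in).
have atomA a : a \in ats ->
    exists2 b : {fset var}, b \in fset0 :: map imA bsA & (fo_free (fatom a) `<=` b)%fset.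
  move=> /atsA[b + ab]; rewrite inE => /orP[/eqP b0|bin].
    exists fset0; rewrite ?mem_head //; apply/fsubsetP => n.
    by rewrite fatom_free => /mapP[x /ab]; rewrite b0 inE.
  exists (imA b); first by rewrite inE map_f ?orbT.
  apply/fsubsetP => n; rewrite fatom_free => /mapP[x /ab xb ->].
  by rewrite (mem_imfset _ _ name_inj).
have szborder r : r \notin S -> #|` border r| <= w.+1.
  by move=> /borderB[b bin /fsubset_leq_card/leq_trans]; apply; apply: szv.
have /choice[theta thetaP] : forall r : {r | proper_root r}, exists q,
    [/\ is_pp q, fo_bound (mA + w.+1) q, (fo_free q `<=` border (val r))%fset
      & forall (B : fstruct tau) (h0 : var -> B), sat (total h0) q <->
          exists h1 : var -> B, (forall x, x \in border (val r) -> h1 x = h0 x) /\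
            forall p, p \in map fatom (touching (val r)) -> sat (total h1) p].
  move=> [r /= pr]; have /andP[rS tr] := pr.
  apply: (@pp_elim _ _ _ (map imA bsA)).
  - by apply: rip_imfset ripA; apply: name_inj.
  - move=> b /szimA bm; rewrite cardfsU; apply: leq_trans (leq_subr _ _) _.
    exact: leq_add bm (szborder _ rS).
  - by case: (touching r) tr.
  - move=> _ /mapP[a + ->]; rewrite mem_filter => /andP[_ /atomA[b bin ab]].
    split=> //.
      rewrite /fo_bound /= andbT; apply: leq_trans (leq_addr _ _).
      exact: leq_trans (fsubset_leq_card ab) (szimA _ bin).
    by exists b => //; apply: fsubset_trans ab (fsubsetUl _ _).
pose RT : finType := {r | proper_root r}.
pose F1 (a : atom tau A) := SC (fatom a) (fo_free (fatom a)).
pose F2 (r : RT) := SC (theta r) (border (val r)).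
pose Fs := map F1 (filter pure ats) ++ map F2 (index_enum RT).
have FsP F : F \in Fs -> [/\ is_sharpPP F, sharp_wf F, sharp_bound s k F,
    exists2 b, b \in fset0 :: bsv & (sharp_free F `<=` b)%fset
  & sharp_closed F = fset0].
  rewrite mem_cat => /orP[/mapP[a + ->]|/mapP[r _ ->]].
    rewrite mem_filter => /andP[pa ain]; have [b bin ab] := pureB a ain pa.
    have ak : #|` fo_free (fatom a)| <= k.
      exact: leq_trans (leq_trans (fsubset_leq_card ab) (szv _ bin)) wk.
    split; [by [] | exact: fsubset_refl | | by exists b | by []].
    by apply/andP; split; [rewrite /= ak | rewrite /= ak orbT].
  have [tpp tk tf _] := thetaP r; have /andP[rS _] := valP r.
  have [b bin rb] := borderB _ rS.
  split; [by [] | by [] | | by exists b | by []].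
  rewrite /sharp_bound /= (leq_trans (szborder _ rS) wk) /=.
  by case/orP: sk => [->//|sk]; apply/orP; right; apply: fo_boundW tk.
have [|||G [Gpp Gwf Gb Gf Ge]] := @sharp_elim tau s k bsv Fs ripv.
- by move=> b bin; apply: leq_trans wk; apply: szv; rewrite inE bin orbT.
- have : forall F, F \in Fs -> sharp_closed F = fset0 by move=> F /FsP[].
  elim: (Fs) => //= F Fs' IH Fc; rewrite IH => [|F' F'in]; last first.
    by apply: Fc; rewrite inE F'in orbT.
  rewrite andbT; apply/allP => F' _; rewrite /closed_disjoint Fc ?mem_head //.
  exact: fdisjoint0X.
- move=> F /FsP[? ? ? ? Fc]; split=> // b _; rewrite Fc; exact: fdisjointX0.
exists G; split=> // B /card_gt0P[b0 _]; rewrite Ge.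
have inc x : nameL x \in fcover bsv.
  have [b bin xb] := covC x; apply/mem_fcover; exists (im b); first exact: map_f.
  by rewrite (mem_imfset _ _ nameL_inj).
have incS n : n \in fcover bsv -> exists x, n = nameL x.
  by move=> /mem_fcover[_ /mapP[b _ ->]] /imfsetP[x _ ->]; exists x.
(* The bags cover exactly the names of liberal variables, so the summation range is the set of maps
   on S. *)
pose T (g : {ffun fcover bsv -> B}) : {ffun lib_type phi -> B} :=
  [ffun x => g [` inc x]%fset].
have T_inj : injective T.
  move=> g g' /ffunP gg; apply/ffunP => z; have [x zx] := incS _ (valP z).
  have := gg x; rewrite !ffunE; suff -> : [` inc x]%fset = z by [].
  by apply: val_inj; rewrite /= -zx.
have T_bij : bijective T.
  apply: inj_card_bij => //; rewrite !card_ffun -cardfE leq_pexp2l //.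
    by apply/card_gt0P; exists b0.
  rewrite cardE -(size_map nameL); apply: uniq_leq_size.
    by rewrite map_inj_uniq ?enum_uniq.
  by move=> _ /mapP[x _ ->]; apply: inc.
rewrite -sum1_card big_mkcond (big_morph Posz PoszD (erefl _)) (reindex T) /=; last first.
  exact: onW_bij.
apply: eq_bigr => g _; set ov := override _ _.
(* Names outside the bags get [b0]; no factor has them free. *)
pose h0 n := odflt b0 (ov n).
have h0E n : n \in fcover bsv -> ov n = total h0 n.
  by rewrite /total /h0 /ov /override => nc; rewrite insubT.
have evF F : F \in Fs -> sharp_eval F ov = sharp_eval F (total h0).
  move=> /FsP[_ Fwf _ [b bin Fb] _]; apply: eq_sharp_eval => // n nF; apply: h0E.
  have nb := fsubsetP Fb _ nF; apply/mem_fcover; exists b => //.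
  by move: bin nb; rewrite inE => /orP[/eqP->|//]; rewrite inE.
rewrite (eq_big_seq _ evF) big_cat !big_map.
rewrite (@prod_bool _ _ _ (fun a => sat (total h0) (fatom a))); last first.
  by move=> a _; rewrite /F1 /sharp_eval; case: (sat _ _).
rewrite (@prod_bool _ _ _ (fun r => sat (total h0) (theta r))); last first.
  by move=> r _; rewrite /F2 /sharp_eval; case: (sat _ _).
apply: etrans (PoszM _ _); rewrite mulnb; congr Posz.
set rhs := (X in _ = nat_of_bool X); suff -> : (T g \in answers phi B) = rhs.
  by case: rhs.
rewrite {}/rhs.
have Th x (xS : x \in S) : T g (Sub x xS) = h0 (name x).
  rewrite ffunE /h0 /ov /override.
  have xc : name x \in fcover bsv := inc (Sub x xS).
  case: insubP => [u _ ux|]; last by rewrite xc.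
  by congr (g _); apply: val_inj; rewrite /= ux.
rewrite inE; apply/asboolP/andP => [[h [hh hT]]|[pa /allP ta]].
  have [|pa ta] := (factors_extend (fun r => (let: And4 _ _ _ H := thetaP r in H) B h0)).2.
    by exists h; split=> // x xS; rewrite -Th -hT.
  by split=> //; apply/allP.
have [|h [hh hS]] := (factors_extend (fun r => (let: And4 _ _ _ H := thetaP r in H) B h0)).1.
  by split=> // r; apply: ta; apply: (mem_index_enum (T := RT)).
exists h; split=> // x; rewrite hS ?(valP x) // -(Th _ (valP x)).
by congr (T g _); apply: val_inj.
Qed.

End Build.

(** Only ♯-subformulas are bounded, so each ∃-component may be handled with the whole universe as
    one bag. *)
Lemma contraction_representation (tau : signature) (phi : pp_formula tau) (w : nat) :
  (forall c : pp_struct phi -> pp_struct phi, core_endo c ->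
     treewidth_le (@contract tau (image_formula c)) w) ->
  exists phi' : sharp tau, sharpPP_representation phi' phi /\ sharp_width phi' <= w.+1.
Proof.
have [c cc] := core_endo_exists phi; move=> /(_ c cc) tw.
have [ats atsE] := pp_atoms (image_formula c).
have [||||||G [Gpp Gwf Gb Gf Ge]] := @build_formula _ _ ats atsE true w w.+1
  #|` [fset x | x in pp_struct (image_formula c)]%fset|
  [:: [fset x | x in pp_struct (image_formula c)]%fset].
- by [].
- by [].
- exact: rip1.
- by move=> b; rewrite inE => /eqP->.
- move=> a _; exists [fset x | x in pp_struct (image_formula c)]%fset.
    by rewrite !inE eqxx orbT.
  by move=> x _; apply/imfsetP; exists x.
- by [].
exists G; split; last by rewrite sharp_widthE.
split=> //; split=> // B B0.
by rewrite -Ge // (card_answers_image _ (proj1 cc)).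
Qed.

Lemma tractability_representation (tau : signature) (phi : pp_formula tau) (w w' : nat) :
  (forall c : pp_struct phi -> pp_struct phi, core_endo c ->
     treewidth_le (@contract tau (image_formula c)) w) ->
  (forall c : pp_struct phi -> pp_struct phi, core_endo c ->
     treewidth_le (@pp_graph tau (image_formula c)) w') ->
  exists phi' : sharp tau, sharpPP_representation phi' phi /\ width phi' <= w'.+1 + w.+1.
Proof.
have [c cc] := core_endo_exists phi; move=> /(_ c cc) tw /(_ c cc).
move=> /treewidth_rip[bs [ripb szb covb edgeb]].
have [ats atsE] := pp_atoms (image_formula c).
have [||||||G [Gpp Gwf Gb Gf Ge]] := @build_formula _ _ ats atsE false w (w'.+1 + w.+1)
  w'.+1 bs.
- by [].
- exact: leq_addl.
- by [].
- by [].
(* The variables of an atom form a clique of the graph and hence share a bag. *)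
- move=> a ain; apply: (rip_clique ripb) => x y xa ya.
  have [<-|xy] := eqVneq x y; last exact/edgeb/(atom_edge atsE ain xa ya xy).
  by have [b bin xb] := covb x; exists b; rewrite ?xb.
- exact: leqnn.
exists G; split; last by rewrite widthE.
split=> //; split=> // B B0.
by rewrite -Ge // (card_answers_image _ (proj1 cc)).
Qed.

Theorem theorem4p1 (tau : signature) (Phi : pp_formula tau -> Prop) :
  (tractability_condition Phi <->
     exists k : nat, 1 <= k /\
       forall phi, Phi phi ->
         exists phi' : sharp tau,
           sharpPP_representation phi' phi /\ width phi' <= k)
  /\
  (contraction_condition Phi <->
     exists k : nat, 1 <= k /\
       forall phi, Phi phi ->
         exists phi' : sharp tau,
           sharpPP_representation phi' phi /\ sharp_width phi' <= k).
Proof.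
split; split.
- move=> [[w cw] [w' gw]]; exists (w'.+1 + w.+1); split=> // phi Pphi.
  exact: tractability_representation (cw _ Pphi) (gw _ Pphi).
- move=> [k [_ rep]]; split; exists k => phi Pphi c cc.
    have [phi' [/representation_embeds[t [dec emb]]]] := rep _ Pphi.
    rewrite geq_max => /andP[]; rewrite -/(sharp_width _) sharp_widthE => /dec d _.
    have [h [hhom hinj hlib]] := emb c cc.
    exact: core_contract_width cc hhom hinj hlib d.
  have [phi' [/representation_embeds[t [dec emb]]]] := rep _ Pphi.
  rewrite widthE => /dec d; have [h [hhom hinj _]] := emb c cc.
  exact: core_graph_width cc hhom hinj d.
- move=> [w cw]; exists w.+1; split=> // phi Pphi.
  exact: contraction_representation (cw _ Pphi).
- move=> [k [_ rep]]; exists k => phi Pphi c cc.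
  have [phi' [/representation_embeds[t [dec emb]]]] := rep _ Pphi.
  rewrite sharp_widthE => /dec d; have [h [hhom hinj hlib]] := emb c cc.
  exact: core_contract_width cc hhom hinj hlib d.
Qed.
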